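(* Let $n\in\{2,3\}$, $k>0$, and let $\delta_1,\delta_2>0$. Suppose the noisy data $u_{\mathrm{sc}}^\delta$ and $\partial u_{\mathrm{sc}}^\delta/\partial\nu$ in $L^2(\partial\Omega\times\mathbb{S}^{n-1})$ satisfy $$\|u_{\mathrm{sc}}-u_{\mathrm{sc}}^\delta\|_{L^2(\partial\Omega\times\mathbb{S}^{n-1})}\le\delta_1\|u_{\mathrm{sc}}\|_{L^2(\partial\Omega\times\mathbb{S}^{n-1})},\qquad \left\|\frac{\partial u_{\mathrm{sc}}}{\partial\nu}-\frac{\partial u_{\mathrm{sc}}^\delta}{\partial\nu}\right\|_{L^2(\partial\Omega\times\mathbb{S}^{n-1})}\le\delta_2\left\|\frac{\partial u_{\mathrm{sc}}}{\partial\nu}\right\|_{L^2(\partial\Omega\times\mathbb{S}^{n-1})}.$$ Let $I(z)$ be the indicator function for the exact data and $I^\delta(z)$ the indicator function corresponding to the noisy data $u_{\mathrm{sc}}^\delta$, $\partial u_{\mathrm{sc}}^\delta/\partial\nu$. Then $$|I(z)-I^\delta(z)|\le\mathcal{C}\left(2\max(\delta_1,\delta_2)+\max(\delta_1^2,\delta_2^2)\right)\quad\text{for all }z\in\mathbb{R}^n,$$ where $$\mathcal{C}=|\mathbb{S}^{n-1}|^2\left(\|\Phi^\infty\|^2_{L^2(\mathbb{S}^{n-1}\times\partial\Omega)}+\left\|\frac{\partial\Phi^\infty}{\partial\nu}\right\|^2_{L^2(\mathbb{S}^{n-1}\times\partial\Omega)}\right)\left(\|u_{\mathrm{sc}}\|^2_{L^2(\partial\Omega\times\mathbb{S}^{n-1})}+\left\|\frac{\partial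 u_{\mathrm{sc}}}{\partial\nu}\right\|^2_{L^2(\partial\Omega\times\mathbb{S}^{n-1})}\right).$$
   Context: Setting. $D\subset\mathbb{R}^n$ is a bounded Lipschitz domain ($n=2$ or $3$) with $\mathbb{R}^n\setminus\overline{D}$ connected, and $\eta:\mathbb{R}^n\to\mathbb{C}$ is bounded with $\operatorname{Im}(\eta)\ge0$ and $\eta=0$ in $\mathbb{R}^n\setminus\overline{D}$. $\mathbb{S}^{n-1}=\{x\in\mathbb{R}^n:|x|=1\}$, and $|\mathbb{S}^{n-1}|$ is its surface area. $\Omega\subset\mathbb{R}^n$ is a bounded Lipschitz domain with $D\subset\Omega$, and $\nu$ is the outward unit normal on $\partial\Omega$. Scattering problem. For $d\in\mathbb{S}^{n-1}$ let $u_{\mathrm{in}}(x,d)=e^{ikx\cdot d}$. The scattered field $u_{\mathrm{sc}}(\cdot,d)\in H^1_{\mathrm{loc}}(\mathbb{R}^n)$ is the unique weak solution such that $u=u_{\mathrm{sc}}+u_{\mathrm{in}}$ satisfies $\Delta u+k^2(1+\eta)u=0$ in $\mathbb{R}^n$ and $u_{\mathrm{sc}}$ satisfies the Sommerfeld radiation condition $\lim_{r\to\infty}r^{(n-1)/2}(\partial u_{\mathrm{sc}}/\partial r-iku_{\mathrm{sc}})=0$, $r=|x|$, uniformly in all directions $x/|x|\in\mathbb{S}^{n-1}$ (well-posedness is known). Indicator function. Let $\Phi^\infty(\hat x,y)=c_ne^{-ik\hat x\cdot y}$ for $\hat x\in\mathbb{S}^{n-1}$, with $c_2=\frac{e^{i\pi/4}}{\sqrt{8\pi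 k}}$ and $c_3=\frac1{4\pi}$ (normal derivatives of $\Phi^\infty$ are taken in $y\in\partial\Omega$), and let $\varphi_z(d)=e^{-ikd\cdot z}$ for $d\in\mathbb{S}^{n-1}$, $z\in\mathbb{R}^n$. Define $$I(z)=\int_{\mathbb{S}^{n-1}}\left|\int_{\mathbb{S}^{n-1}}\left(\int_{\partial\Omega}\Big[u_{\mathrm{sc}}(y,d)\frac{\partial\Phi^\infty(\hat x,y)}{\partial\nu(y)}-\frac{\partial u_{\mathrm{sc}}(y,d)}{\partial\nu(y)}\Phi^\infty(\hat x,y)\Big]ds(y)\right)\varphi_z(d)\,ds(d)\right|^2ds(\hat x).$$ $I^\delta(z)$ is defined by the same formula with $u_{\mathrm{sc}}$ and $\partial u_{\mathrm{sc}}/\partial\nu$ replaced by $u_{\mathrm{sc}}^\delta$ and $\partial u_{\mathrm{sc}}^\delta/\partial\nu$ respectively. Here $\partial u_{\mathrm{sc}}^\delta/\partial\nu$ is simply notation for the noisy measurement of $\partial u_{\mathrm{sc}}/\partial\nu$. *)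

(* Defs.v *)
From HB Require Import structures.
From mathcomp Require Import all_boot all_order all_algebra.
From mathcomp Require Import complex.
From mathcomp Require Import all_classical all_reals all_analysis.

Set Implicit Arguments.
Unset Strict Implicit.
Unset Printing Implicit Defensive.

Import Order.TTheory GRing.Theory Num.Theory.
Import numFieldNormedType.Exports.

Local Open Scope classical_set_scope.
Local Open Scope ring_scope.
Local Open Scope complex_scope.

(* The library norm on ['rV[R]_n] is the sup norm: same topology, but
   lengths and diameters below must be Euclidean. *)
Section euclidean.
Context {R : realType} {n : nat}.
Implicit Types (x y v : 'rV[R]_n) (A : set 'rV[R]_n).

Definition dot x y : R := \sum_i x ord0 i * y ord0 i.

Definition enorm x : R := Num.sqrt (dot x x).

Definition sphere : set 'rV[R]_n := [set x | enorm x = 1].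

Definition bdry A : set 'rV[R]_n := closure A `\` interior A.

(* Near each boundary point p, in coordinates where e is the vertical
   direction, Omega is the region above the graph of the Lipschitz function
   zeta of the horizontal component w - (w . e) e, where w = x - p. *)
Definition lipschitz_boundary (Omega : set 'rV[R]_n) :=
  forall p, bdry Omega p ->
  exists (e : 'rV[R]_n) (zeta : 'rV[R]_n -> R) (L r : R),
    [/\ enorm e = 1,
        0 < r,
        (forall x y, `|zeta x - zeta y| <= L * enorm (x - y)) &
        forall x, enorm (x - p) < r ->
          let w := x - p in
          (Omega x <-> zeta (w - dot w e *: e) < dot w e)].

Definition bounded_lipschitz_domain (Omega : set 'rV[R]_n) :=
  [/\ Omega !=set0, open Omega, connected Omega, bounded_set Omega &
      lipschitz_boundary Omega].

(* v is the outward unit normal at y: every cone with apex y and axis -v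
   (resp. v) is, close to y, inside (resp. outside) Omega. *)
Definition outward_unit_normal_at (Omega : set 'rV[R]_n) y v :=
  enorm v = 1 /\
  forall eps : R, 0 < eps -> exists2 r, 0 < r &
    forall x, 0 < enorm (x - y) < r ->
      (dot (x - y) v < - (eps * enorm (x - y)) -> Omega x) /\
      (eps * enorm (x - y) < dot (x - y) v -> ~ Omega x).

End euclidean.

Section cover_measure.
Local Open Scope ereal_scope.
Context {R : realType} {T : Type}.
Implicit Types (c : set T -> \bar R).

Definition cover_measure c (X : set T) : \bar R :=
  ereal_inf [set \sum_(k <oo) c (F k)
            | F in [set F : (set T)^nat | X `<=` \bigcup_k F k]].

End cover_measure.

(* [cover_measure] is [mu_ext] for the sigma-algebra of all subsets. *)
Definition powerset_type (T : Type) : Type := T.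
Definition powerset_display : measure_display. Proof. exact. Qed.

Section powerset_type.
Variable T : pointedType.
Let pmeas : set (set (powerset_type T)) := setT.
Let pmeas0 : pmeas set0. Proof. by []. Qed.
Let pmeasC A : pmeas A -> pmeas (~` A). Proof. by []. Qed.
Let pmeasU (F : (set (powerset_type T))^nat) :
  (forall i, pmeas (F i)) -> pmeas (\bigcup_i F i).
Proof. by []. Qed.
HB.instance Definition _ := Pointed.copy (powerset_type T) T.
HB.instance Definition _ := @isMeasurable.Build powerset_display
  (powerset_type T) pmeas pmeas0 pmeasC pmeasU.
End powerset_type.

Section cover_measure_theory.
Local Open Scope ereal_scope.
Context {R : realType} {T : pointedType}.
Variable c : set T -> \bar R.
Hypotheses (c0 : c set0 = 0) (c_ge0 : forall A, 0 <= c A).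

Lemma cover_measureE :
  cover_measure c = @mu_ext _ (powerset_type T) R c.
Proof.
apply/funext => X; congr ereal_inf; apply/seteqP; split => _ [F /= XF <-].
  by exists F.
by case: XF => _ XF; exists F.
Qed.

Lemma cover_measure0 : cover_measure c set0 = 0.
Proof. by rewrite cover_measureE mu_ext0. Qed.

Lemma cover_measure_ge0 X : 0 <= cover_measure c X.
Proof. by rewrite cover_measureE mu_ext_ge0. Qed.

Lemma le_cover_measure :
  {homo cover_measure c : A B / A `<=` B >-> A <= B}.
Proof. by move=> A B AB; rewrite cover_measureE le_mu_ext. Qed.

Lemma cover_measure_sigma_subadditive :
  sigma_subadditive (cover_measure c).
Proof.
move=> F; rewrite cover_measureE.
exact: (@mu_ext_sigma_subadditive _ (powerset_type T)).
Qed.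

End cover_measure_theory.

Section lebesgue_rV.
Local Open Scope ereal_scope.
Context {R : realType} (n : nat).
Implicit Types (a b : 'rV[R]_n) (A : set 'rV[R]_n).

Definition box a b : set 'rV[R]_n :=
  [set x | forall i, (a ord0 i <= x ord0 i < b ord0 i)%R].

(* The volume of A if A is a (half-open) box, +oo otherwise. *)
Definition box_gauge A : \bar R :=
  if A == set0 then 0 else
  ereal_inf [set (\prod_i (ab.2 ord0 i - ab.1 ord0 i)%R)%:E
            | ab in [set ab : 'rV[R]_n * 'rV[R]_n | A = box ab.1 ab.2]].

Definition lebesgue_outer : set 'rV[R]_n -> \bar R := cover_measure box_gauge.

Lemma box_gauge0 : box_gauge set0 = 0.
Proof. by rewrite /box_gauge eqxx. Qed.

Lemma box_gauge_ge0 A : 0 <= box_gauge A.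
Proof.
rewrite /box_gauge; case: eqP => // /eqP/set0P[x Ax].
apply: le_ereal_inf_tmp => _ [[a b] /= Aab <-]; rewrite lee_fin.
apply: prodr_ge0 => i _; rewrite subr_ge0.
by move: Ax; rewrite Aab => /(_ i)/andP[ax xb]; rewrite (le_trans ax) ?ltW.
Qed.

HB.instance Definition _ := isOuterMeasure.Build R 'rV[R]_n lebesgue_outer
  (cover_measure0 box_gauge0 box_gauge_ge0)
  (cover_measure_ge0 box_gauge_ge0)
  (@le_cover_measure _ _ box_gauge)
  (cover_measure_sigma_subadditive box_gauge_ge0).

Definition lebesgue_rV :
    {measure set (caratheodory_type lebesgue_outer) -> \bar R} :=
  (lebesgue_outer : {outer_measure set 'rV[R]_n -> \bar R})
  : set (caratheodory_type lebesgue_outer) -> \bar R.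

End lebesgue_rV.

Section hausdorff.
Local Open Scope ereal_scope.
Context {R : realType} {n : nat}.
Implicit Types (m : nat) (delta : R) (A B : set 'rV[R]_n).

(* The volume of the unit ball of R^m, which normalizes the Hausdorff
   measure so that it is the usual arc length and surface area. *)
Fixpoint unit_ball_volume m : R :=
  match m with
  | 0 => 1
  | 1 => 2
  | (k.+1 as p).+1 => (2 * pi / p.+1%:R * unit_ball_volume k)%R
  end.

Definition ediam A : \bar R :=
  ereal_sup [set (enorm (xy.1 - xy.2))%:E | xy in A `*` A].

Definition hausdorff_gauge m delta A : \bar R :=
  if A == set0 then 0 else
  if ediam A <= delta%:E
  then (unit_ball_volume m * (fine (ediam A) / 2) ^+ m)%:E
  else +oo.

Definition hausdorff m A : \bar R :=
  ereal_sup [set cover_measure (hausdorff_gauge m delta) A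
            | delta in [set delta | (0 < delta)%R]].

Definition surface_outer m B A : \bar R := hausdorff m (A `&` B).

Lemma hausdorff_gauge0 m delta : hausdorff_gauge m delta set0 = 0.
Proof. by rewrite /hausdorff_gauge eqxx. Qed.

Lemma unit_ball_volume_ge0 m : (0 <= unit_ball_volume m)%R.
Proof.
suff : (0 <= unit_ball_volume m /\ 0 <= unit_ball_volume m.+1)%R by case.
elim: m => [|m [IH IH1]]; first by split.
split => //; rewrite [unit_ball_volume m.+2]/=.
by rewrite mulr_ge0// divr_ge0// mulr_ge0// pi_ge0.
Qed.

Lemma hausdorff_gauge_ge0 m delta A : 0 <= hausdorff_gauge m delta A.
Proof.
rewrite /hausdorff_gauge; case: eqP => // /eqP/set0P[x Ax].
case: ifP => // _; rewrite lee_fin mulr_ge0 ?unit_ball_volume_ge0//.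
rewrite exprn_ge0// divr_ge0// fine_ge0//.
apply: (@le_trans _ _ (enorm (x - x))%:E); first by rewrite lee_fin sqrtr_ge0.
by apply: ereal_sup_ubound; exists (x, x).
Qed.

Lemma surface_outer0 m B : surface_outer m B set0 = 0.
Proof.
rewrite /surface_outer /hausdorff set0I.
apply/eqP; rewrite eq_le; apply/andP; split.
  apply: ge_ereal_sup => _ [delta _ <-].
  by rewrite (cover_measure0 (hausdorff_gauge0 m delta)
               (hausdorff_gauge_ge0 m delta)).
apply: ereal_sup_ubound; exists 1%R => //=.
by rewrite (cover_measure0 (hausdorff_gauge0 m 1%R) (hausdorff_gauge_ge0 m 1%R)).
Qed.

Lemma surface_outer_ge0 m B A : 0 <= surface_outer m B A.
Proof.
apply: (@le_trans _ _
    (cover_measure (hausdorff_gauge m 1%R) (A `&` B))).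
  exact: (cover_measure_ge0 (hausdorff_gauge_ge0 m 1%R)).
by apply: ereal_sup_ubound; exists 1%R => //=.
Qed.

Lemma le_surface_outer m B :
  {homo surface_outer m B : A A' / A `<=` A' >-> A <= A'}.
Proof.
move=> A A' AA'; apply: ge_ereal_sup => _ [delta /= d0 <-].
apply: (@le_trans _ _ (cover_measure (hausdorff_gauge m delta) (A' `&` B))).
  by apply: le_cover_measure; exact: setSI.
by apply: ereal_sup_ubound; exists delta.
Qed.

Lemma surface_outer_sigma_subadditive m B :
  sigma_subadditive (surface_outer m B).
Proof.
move=> F; apply: ge_ereal_sup => _ [delta /= d0 <-]; rewrite setI_bigcupl.
apply: (le_trans (cover_measure_sigma_subadditive
  (hausdorff_gauge_ge0 m delta) (fun i => F i `&` B))).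
apply: lee_nneseries => i *.
  exact: (cover_measure_ge0 (hausdorff_gauge_ge0 m delta)).
by apply: ereal_sup_ubound; exists delta.
Qed.

HB.instance Definition _ m B := isOuterMeasure.Build R 'rV[R]_n
  (surface_outer m B) (surface_outer0 m B) (surface_outer_ge0 m B)
  (@le_surface_outer m B) (@surface_outer_sigma_subadditive m B).

(* ds on B: the (n-1)-dimensional Hausdorff measure restricted to B, on the
   sigma-algebra of its Caratheodory-measurable sets.  Restricting the outer
   measure, rather than the measure, needs no measurability of B. *)
Definition surface B :
    {measure set (caratheodory_type (surface_outer n.-1 B)) -> \bar R} :=
  (surface_outer n.-1 B : {outer_measure set 'rV[R]_n -> \bar R})
  : set (caratheodory_type (surface_outer n.-1 B)) -> \bar R.

End hausdorff.

Definition expi {R : realType} (t : R) : R[i] := cos t +i* sin t.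

Definition modulus {R : realType} (z : R[i]) : R := ComplexField.Normc.normc z.

Definition cmeasurable d (T : measurableType d) (R : realType)
    (D : set T) (f : T -> R[i]) :=
  measurable_fun D (fun x => complex.Re (f x)) /\
  measurable_fun D (fun x => complex.Im (f x)).

Definition cintegral d (T : measurableType d) (R : realType)
    (mu : {measure set T -> \bar R}) (D : set T) (f : T -> R[i]) : R[i] :=
  (\int[mu]_(x in D) complex.Re (f x)) +i* (\int[mu]_(x in D) complex.Im (f x)).

(* The measure is a bare set function so that products of measures that are
   only finite on the sets of interest can be used. *)
Definition L2 d (T : measurableType d) (R : realType)
    (mu : set T -> \bar R) (D : set T) (f : T -> R[i]) :=
  cmeasurable D f /\
  (\int[mu]_(x in D) (modulus (f x) ^+ 2)%:E < +oo)%E.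

Definition L2norm d (T : measurableType d) (R : realType)
    (mu : set T -> \bar R) (D : set T) (f : T -> R[i]) : R :=
  Num.sqrt (fine (\int[mu]_(x in D) (modulus (f x) ^+ 2)%:E)%E).

Section surface_product.
Context {R : realType} {n : nat}.
Implicit Types (A B : set 'rV[R]_n) (f : 'rV[R]_n -> 'rV[R]_n -> R[i]).

Definition L2_prod A B f :=
  L2 (surface A \x surface B)%E (A `*` B) (fun p => f p.1 p.2).

Definition L2norm_prod A B f : R :=
  L2norm (surface A \x surface B)%E (A `*` B) (fun p => f p.1 p.2).

End surface_product.

Section sobolev.
Context {R : realType} {n : nat}.
Implicit Types (x : 'rV[R]_n) (U Omega : set 'rV[R]_n)
  (phi : 'rV[R]_n -> R) (u g h : 'rV[R]_n -> R[i])
  (G : 'I_n -> 'rV[R]_n -> R[i]).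

Definition partial (i : 'I_n) phi x : R := 'D_(delta_mx ord0 i) phi x.

Definition cderive u x (v : 'rV[R]_n) : R[i] :=
  ('D_v (fun y => complex.Re (u y)) x) +i* ('D_v (fun y => complex.Im (u y)) x).

Fixpoint Ck (k : nat) phi : Prop :=
  continuous phi /\
  if k is k'.+1 then
    forall i, (forall x, derivable phi x (delta_mx ord0 i)) /\
              Ck k' (partial i phi)
  else True.

Definition Cinfty phi := forall k, Ck k phi.

Definition cCinfty u :=
  Cinfty (fun x => complex.Re (u x)) /\ Cinfty (fun x => complex.Im (u x)).

Definition test_function U phi :=
  Cinfty phi /\
  exists K, [/\ compact K, K `<=` U & forall x, ~ K x -> phi x = 0].

(* Real test functions suffice: both sides are complex-linear in phi. *)
Definition weak_gradient U u G :=
  forall i phi, test_function U phi ->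
    cintegral (lebesgue_rV n) U (fun x => u x * (partial i phi x)%:C) =
    - cintegral (lebesgue_rV n) U (fun x => G i x * (phi x)%:C).

Definition H1 U u G :=
  [/\ L2 (lebesgue_rV n) U u, (forall i, L2 (lebesgue_rV n) U (G i)) &
      weak_gradient U u G].

Definition locL2 u :=
  forall r : R, L2 (lebesgue_rV n) [set x | enorm x <= r] u.

Definition H1loc u G :=
  [/\ locL2 u, (forall i, locL2 (G i)) & weak_gradient setT u G].

(* g is the trace of u in H^1(Omega): the continuous extension to H^1(Omega)
   of the restriction of smooth functions to the boundary. *)
Definition is_trace Omega u g :=
  exists G, [/\ H1 Omega u G,
    L2 (surface (bdry Omega)) (bdry Omega) g &
    forall eps : R, 0 < eps -> exists psi, [/\ cCinfty psi,
      L2norm (lebesgue_rV n) Omega (fun x => psi x - u x) <= eps,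
      (forall i, L2norm (lebesgue_rV n) Omega
        (fun x => cderive psi x (delta_mx ord0 i) - G i x) <= eps) &
      L2norm (surface (bdry Omega)) (bdry Omega)
        (fun y => psi y - g y) <= eps]].

(* A representative of the outward unit normal, which exists only almost
   everywhere on a Lipschitz boundary. *)
Definition outward_unit_normal Omega (nu : 'rV[R]_n -> 'rV[R]_n) :=
  (forall i, measurable_fun
     (bdry Omega : set (caratheodory_type (surface_outer n.-1 (bdry Omega))))
     (fun y : caratheodory_type (surface_outer n.-1 (bdry Omega)) =>
        nu y ord0 i)) /\
  {ae surface (bdry Omega), forall y, bdry Omega y ->
     outward_unit_normal_at Omega y (nu y)}.

(* h = nu . grad u on the boundary, with grad u taken in the sense of
   traces. *)
Definition is_normal_trace Omega (nu : 'rV[R]_n -> 'rV[R]_n) u h :=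
  exists G (g : 'I_n -> 'rV[R]_n -> R[i]), [/\ H1 Omega u G,
    (forall i, is_trace Omega (G i) (g i)) &
    {ae surface (bdry Omega), forall y, bdry Omega y ->
      h y = \sum_i (nu y ord0 i)%:C * g i y}].

End sobolev.

Section scattering.
Context {R : realType} {n : nat}.
Implicit Types (k : R) (x y d z : 'rV[R]_n) (eta us : 'rV[R]_n -> R[i])
  (Omega : set 'rV[R]_n) (nu : 'rV[R]_n -> 'rV[R]_n)
  (f g : 'rV[R]_n -> 'rV[R]_n -> R[i]).

Definition contrast (D : set 'rV[R]_n) eta :=
  [/\ cmeasurable (setT : set (caratheodory_type (@lebesgue_outer R n))) eta,
      (exists M : R, forall x, modulus (eta x) <= M),
      (forall x, 0 <= complex.Im (eta x)) &
      forall x, ~ closure D x -> eta x = 0].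

Definition u_in k x d : R[i] := expi (k * dot x d).

(* Delta u + k^2 (1 + eta) u = 0 in R^n, weakly. *)
Definition weak_helmholtz k eta (u : 'rV[R]_n -> R[i]) :=
  exists2 G, H1loc u G &
    forall phi, test_function setT phi ->
      cintegral (lebesgue_rV n) setT
        (fun x => \sum_i G i x * (partial i phi x)%:C) =
      cintegral (lebesgue_rV n) setT
        (fun x => (k ^+ 2)%:C * (1 + eta x) * u x * (phi x)%:C).

(* The radiation condition selects the representative of us that is
   differentiable far from the origin. *)
Definition sommerfeld k us :=
  forall eps : R, 0 < eps -> exists r0 : R, forall x, r0 < enorm x ->
    let r := enorm x in
    [/\ 0 < r,
        differentiable (fun y => complex.Re (us y)) x,
        differentiable (fun y => complex.Im (us y)) x &
        modulus ((r `^ ((n%:R - 1) / 2))%:C *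
          (cderive us x (r^-1 *: x) - 'i * k%:C * us x)) <= eps].

Definition scattered_field k eta d us :=
  [/\ (exists G, H1loc us G),
      weak_helmholtz k eta (fun x => us x + u_in k x d) &
      sommerfeld k us].

Definition far_field_constant k : R[i] :=
  if n == 2%N then expi (pi / 4) / (Num.sqrt (8 * pi * k))%:C
  else ((4 * pi)^-1)%:C.

Definition Phi_inf k xhat y : R[i] :=
  far_field_constant k * expi (- (k * dot xhat y)).

Definition dnu_Phi_inf nu k xhat y : R[i] := cderive (Phi_inf k xhat) y (nu y).

Definition phi_z k z d : R[i] := expi (- (k * dot d z)).

(* f and g are the Dirichlet and Neumann data, as functions of (y, d). *)
Definition indicator Omega nu k f g z : R :=
  \int[surface sphere]_(xhat in sphere)
    modulus (cintegral (surface sphere) sphere (fun d =>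
      cintegral (surface (bdry Omega)) (bdry Omega) (fun y =>
        f y d * dnu_Phi_inf nu k xhat y - g y d * Phi_inf k xhat y)
      * phi_z k z d)) ^+ 2.

Definition sphere_area : R := fine (surface sphere (@sphere R n)).

End scattering.

(* Main.v *)
From HB Require Import structures.
Require Import Defs.
From mathcomp Require Import all_boot all_order all_algebra finmap.
From mathcomp Require Import complex ring lra.
From mathcomp Require Import all_classical all_reals all_analysis.
From mathcomp Require Import measurable_realfun.

(* Put A(xhat) for the inner double integral of the indicator.  By Fubini it is
   one integral over the product of the boundary of Omega and the sphere, hence
   linear in the data (u, dnu_u), and Cauchy-Schwarz gives
     |A(xhat)|^2 <= |S| (|u|^2 + |dnu_u|^2) N(xhat),
   where N(xhat) is the sum of the squared L^2(bdry Omega) norms of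
   Phi_inf(xhat, .) and its normal derivative.  Applied to the exact data and to
   the difference of the data, with t = max(delta1, delta2), this yields
     ||A|^2 - |A'|^2| <= |A - A'| (2 |A| + |A - A'|)
                      <= |S| (|u|^2 + |dnu_u|^2) N(xhat) (2 t + t^2),
   and integrating over xhat gives the estimate with |S| instead of |S|^2.
   It remains to see that |S| >= 1 (project the sphere onto a segment or a
   square) and that Fubini applies: the Hausdorff measures of the sphere and of
   the boundary are finite (both are locally Lipschitz graphs), and coordinate
   half-spaces are Caratheodory measurable. *)

Set Implicit Arguments.
Unset Strict Implicit.
Unset Printing Implicit Defensive.

Import Order.TTheory GRing.Theory Num.Theory.
Import numFieldNormedType.Exports.
Local Open Scope classical_set_scope.
Local Open Scope ring_scope.
Local Open Scope complex_scope.

(** * Complex integrals and square-integrable functions *)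

Section complex_facts.
Context {R : realType}.
Implicit Types (z w : R[i]).

(** The factor [|S|] in the pointwise bound is the squared norm of the phase [phi_z], which has
    modulus 1: on the product of boundary and sphere, the data are paired with products of a
    function of [(xhat, y)] and [phi_z(d)]. Cauchy-Schwarz is itself derived from pointwise AM-GM
    with a free parameter, so only the integrability of squared moduli is used. The obstacle is
    measure-theoretic: [surface B] lives on the Caratheodory sigma-algebra of a restricted outer
    measure, for which neither finite mass nor measurability of continuous functions is given in
    advance. Finite mass makes product measures available; measurability of the coordinates comes
    from additivity of Hausdorff measure on sets separated along one axis. The analytic estimate is
    therefore stated for abstract finite measures and kernels, on whole spaces, with data extended
    by zero. *)

Lemma modulus_ge0 z : 0 <= modulus z.
Proof. by case: z => a b; rewrite /modulus sqrtr_ge0. Qed.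

Lemma sqr_modulus z :
  modulus z ^+ 2 = complex.Re z ^+ 2 + complex.Im z ^+ 2.
Proof. by case: z => a b; rewrite /modulus /= sqr_sqrtr// addr_ge0// sqr_ge0. Qed.

Lemma modulusM z w : modulus (z * w) = modulus z * modulus w.
Proof. exact: ComplexField.Normc.normcM. Qed.

Lemma ler_modulusB z w : modulus (z - w) <= modulus z + modulus w.
Proof.
by rewrite /modulus -(normcN w); exact: le_normcD.
Qed.

Lemma ler_dist_modulus z w : `|modulus z - modulus w| <= modulus (z - w).
Proof.
have H (a b : R[i]) : modulus a - modulus b <= modulus (a - b).
  rewrite lerBlDr -{1}(subrK b a) -{2}(opprK b) (le_trans (ler_modulusB _ _))//.
  by rewrite lerD2l /modulus normcN.
rewrite ler_norml H andbT lerNl opprB (le_trans (H _ _))//.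
by rewrite /modulus -normcN opprB.
Qed.

Lemma normr_Re_le z : `|complex.Re z| <= modulus z.
Proof.
rewrite -(ler_pXn2r (n := 2)) ?nnegrE ?modulus_ge0// sqr_modulus real_normK ?num_real//.
by rewrite lerDl sqr_ge0.
Qed.

Lemma normr_Im_le z : `|complex.Im z| <= modulus z.
Proof.
rewrite -(ler_pXn2r (n := 2)) ?nnegrE ?modulus_ge0// sqr_modulus real_normK ?num_real//.
by rewrite lerDr sqr_ge0.
Qed.

Lemma ReM z w : complex.Re (z * w) =
  complex.Re z * complex.Re w - complex.Im z * complex.Im w.
Proof. by case: z w => [a b] [c e]. Qed.

Lemma ImM z w : complex.Im (z * w) =
  complex.Re z * complex.Im w + complex.Im z * complex.Re w.
Proof. by case: z w => [a b] [c e]. Qed.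

Lemma ReB z w : complex.Re (z - w) = complex.Re z - complex.Re w.
Proof. by case: z w => [a b] [c e]. Qed.

Lemma ImB z w : complex.Im (z - w) = complex.Im z - complex.Im w.
Proof. by case: z w => [a b] [c e]. Qed.

End complex_facts.

Section cmeasurable.
Context d (T : measurableType d) {R : realType}.
Implicit Types (D : set T) (f g : T -> R[i]).

Lemma cmeasurableB D f g : cmeasurable D f -> cmeasurable D g ->
  cmeasurable D (fun x => f x - g x).
Proof.
move=> [f1 f2] [g1 g2]; split.
  by under eq_fun do rewrite ReB; exact: measurable_funB.
by under eq_fun do rewrite ImB; exact: measurable_funB.
Qed.

Lemma cmeasurableM D f g : cmeasurable D f -> cmeasurable D g ->
  cmeasurable D (fun x => f x * g x).
Proof.
move=> [f1 f2] [g1 g2]; split.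
  by under eq_fun do rewrite ReM; apply: measurable_funB; exact: measurable_funM.
by under eq_fun do rewrite ImM; apply: measurable_funD; exact: measurable_funM.
Qed.

Lemma measurable_sqr_modulus D f : cmeasurable D f ->
  measurable_fun D (fun x => modulus (f x) ^+ 2).
Proof.
move=> [f1 f2]; under eq_fun do rewrite sqr_modulus.
by apply: measurable_funD; exact: measurable_funX.
Qed.

End cmeasurable.

Lemma cmeasurableT_comp d1 d2 (T1 : measurableType d1) (T2 : measurableType d2)
    (R : realType) (f : T2 -> R[i]) (h : T1 -> T2) :
  cmeasurable setT f -> measurable_fun setT h -> cmeasurable setT (fun x => f (h x)).
Proof.
move=> [f1 f2] mh.
by split; [exact: (measurableT_comp f1 mh)|exact: (measurableT_comp f2 mh)].
Qed.

Section integrable_real.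
Context d (T : measurableType d) {R : realType} (m : {measure set T -> \bar R}).
Implicit Types (f g : T -> R) (D : set T).

Lemma integrable_mull D f r : measurable D -> m.-integrable D (EFin \o f) ->
  m.-integrable D (EFin \o (fun x => r * f x)).
Proof.
move=> mD fi; rewrite (_ : EFin \o _ = fun x => (r%:E * (EFin \o f) x)%E)//.
exact: integrableZl.
Qed.

Lemma integrable_addr D f g : measurable D -> m.-integrable D (EFin \o f) ->
  m.-integrable D (EFin \o g) -> m.-integrable D (EFin \o (fun x => f x + g x)).
Proof. by move=> mD fi gi; have := integrableD mD fi gi. Qed.

End integrable_real.

Section square_integrable.
Context d (T : measurableType d) {R : realType} (m : {measure set T -> \bar R}).
Implicit Types (f g : T -> R[i]).

Definition sqnorm f : R := \int[m]_x modulus (f x) ^+ 2.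

Lemma sqnorm_ge0 f : 0 <= sqnorm f.
Proof. by apply: Rintegral_ge0 => x _; exact: sqr_ge0. Qed.

Lemma L2_integrable f : L2 m setT f ->
  m.-integrable setT (EFin \o (fun x => modulus (f x) ^+ 2)).
Proof.
move=> [mf foo]; apply/integrableP; split.
  exact/measurable_EFinP/measurable_sqr_modulus.
by under eq_integral do rewrite /= ger0_norm ?sqr_ge0//.
Qed.

(** Domination by [2|f|^2 + 2|g|^2], which exceeds [|f - g|^2] by [|f + g|^2]. *)
Lemma L2B f g : L2 m setT f -> L2 m setT g -> L2 m setT (fun x => f x - g x).
Proof.
move=> Lf Lg; have mfg := cmeasurableB Lf.1 Lg.1; split => //.
have Hi : m.-integrable setT
   (EFin \o (fun x => 2 * modulus (f x) ^+ 2 + 2 * modulus (g x) ^+ 2)).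
  by apply: integrable_addr => //; apply: integrable_mull => //; exact: L2_integrable.
case/integrableP : Hi => mh hoo; apply: le_lt_trans hoo.
apply: ge0_le_integral => //=.
- by move=> x _; rewrite lee_fin sqr_ge0.
- exact/measurable_EFinP/measurable_sqr_modulus.
- by apply/measurable_EFinP/measurableT_comp => //; exact/measurable_EFinP.
move=> x _; rewrite lee_fin (le_trans _ (ler_norm _))//.
rewrite !sqr_modulus ReB ImB.
set a := complex.Re _; set b := complex.Re _.
set c := complex.Im _; set e := complex.Im _.
have := sqr_ge0 (a + b); have := sqr_ge0 (c + e); lra.
Qed.

End square_integrable.

Section cintegral_facts.
Context d (T : measurableType d) {R : realType} (m : {measure set T -> \bar R}).
Implicit Types (f g : T -> R[i]).

Definition cintegrable f :=
  m.-integrable setT (EFin \o (fun x => complex.Re (f x))) /\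
  m.-integrable setT (EFin \o (fun x => complex.Im (f x))).

Lemma cintegrable_le f (h : T -> R) : cmeasurable setT f ->
  m.-integrable setT (EFin \o h) -> (forall x, modulus (f x) <= h x) ->
  cintegrable f.
Proof.
move=> [f1 f2] ih fh; split; apply: (le_integrable measurableT _ _ ih) => //=.
- exact/measurable_EFinP.
- by move=> x _; rewrite lee_fin (le_trans (normr_Re_le _))// (le_trans (fh x))//
    ler_norm.
- exact/measurable_EFinP.
- by move=> x _; rewrite lee_fin (le_trans (normr_Im_le _))// (le_trans (fh x))//
    ler_norm.
Qed.

Lemma cintegralB f g : cintegrable f -> cintegrable g ->
  cintegral m setT (fun x => f x - g x) = cintegral m setT f - cintegral m setT g.
Proof.
move=> [f1 f2] [g1 g2]; rewrite /cintegral.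
under eq_Rintegral do rewrite ReB.
under [X in _ +i* X = _]eq_Rintegral do rewrite ImB.
by rewrite RintegralB// RintegralB.
Qed.

Lemma cintegralZr f (c : R[i]) : cintegrable f ->
  cintegral m setT (fun x => f x * c) = cintegral m setT f * c.
Proof.
move=> [f1 f2]; rewrite /cintegral.
under eq_Rintegral do rewrite ReM.
under [X in _ +i* X = _]eq_Rintegral do rewrite ImM.
have ir (h : T -> R) (r : R) : m.-integrable setT (EFin \o h) ->
    m.-integrable setT (EFin \o (fun x => h x * r)).
  by move=> ih; under eq_fun do rewrite mulrC; exact: integrable_mull.
rewrite RintegralB ?RintegralD ?RintegralZr//; try exact: ir.
by case: c.
Qed.

(* Bound the component of the integrand along the direction of its integral. *)
Lemma modulus_cintegral_le f (h : T -> R) : cintegrable f ->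
  m.-integrable setT (EFin \o h) -> (forall x, modulus (f x) <= h x) ->
  modulus (cintegral m setT f) <= \int[m]_x h x.
Proof.
move=> [f1 f2] ih fh; set z := cintegral _ _ _.
have [z0|z0] := eqVneq (modulus z) 0.
  rewrite z0; apply: Rintegral_ge0 => x _.
  exact: le_trans (modulus_ge0 _) (fh x).
have zp : 0 < modulus z by rewrite lt_neqAle eq_sym z0 modulus_ge0.
pose a := complex.Re z; pose b := complex.Im z.
have zE : modulus z ^+ 2 = \int[m]_x (a * complex.Re (f x) + b * complex.Im (f x)).
  rewrite RintegralD//; [|exact: (@integrable_mull _ _ _ _ _ _ a _ f1)
    |exact: (@integrable_mull _ _ _ _ _ _ b _ f2)].
  by rewrite !RintegralZl// sqr_modulus !expr2.
rewrite -(ler_pM2l zp) -expr2 zE.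
rewrite -RintegralZl//; apply: le_Rintegral => //.
- by apply: integrable_addr => //; apply: integrable_mull.
- exact: integrable_mull.
move=> x _; apply: (@le_trans _ _ (modulus z * modulus (f x))); last first.
  by rewrite /= ler_wpM2l ?modulus_ge0.
rewrite /a /b.
apply: (le_trans (ler_norm _)).
rewrite -(ler_pXn2r (n := 2)) ?nnegrE ?mulr_ge0 ?modulus_ge0//.
rewrite exprMn !sqr_modulus real_normK ?num_real//.
set u := complex.Re (f x); set v := complex.Im (f x).
(* Lagrange's identity: this square is the defect in Cauchy-Schwarz for two plane vectors. *)
have := sqr_ge0 (complex.Re z * v - complex.Im z * u); nra.
Qed.

End cintegral_facts.

(** * Integral operators on a product space *)

(** Cauchy-Schwarz from a family of AM-GM inequalities. The value [t = a / b] already gives the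
    claim, without a square root; for [b = 0] the value [t = (c + 1) / a] would force [a <= 0], and
    the [+ 1] keeps it positive when [c = 0]. *)
Lemma sqr_le_of_amgm (R : realFieldType) (a b c : R) :
  0 <= a -> 0 <= b -> 0 <= c ->
  (forall t, 0 < t -> 2 * a <= t * b + t^-1 * c) -> a ^+ 2 <= b * c.
Proof.
move=> a0 b0 c0 H; have [->|an0] := eqVneq a 0.
  by rewrite expr0n/= mulr_ge0.
have {an0 a0}a0 : 0 < a by rewrite lt_neqAle eq_sym an0.
have [b00|bn0] := eqVneq b 0.
  have c1 : 0 < c + 1 by lra.
  have := H ((c + 1) / a); rewrite divr_gt0// => /(_ isT).
  rewrite b00 mulr0 add0r invf_div -mulrA (mulrC _ c) => ca.
  have : c / (c + 1) <= 1 by rewrite ler_pdivrMr//; lra.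
  by rewrite -(ler_pM2l a0); lra.
have {bn0 b0}b0 : 0 < b by rewrite lt_neqAle eq_sym bn0.
have := H (a / b); rewrite divr_gt0// => /(_ isT).
rewrite divfK ?gt_eqF// invf_div mulrAC => ca.
have : a <= b * c / a by lra.
by rewrite ler_pdivlMr// expr2.
Qed.

Section iterated_Rintegral.
Context d1 d2 (T1 : measurableType d1) (T2 : measurableType d2) {R : realType}.
Variables (m1 : {sigma_finite_measure set T1 -> \bar R})
  (m2 : {sigma_finite_measure set T2 -> \bar R}).
Implicit Type h : T1 * T2 -> R.

(** [Rintegral] is [fine] of a difference of two integrals of nonnegative functions, each measurable
    in the parameter by Tonelli. *)
Lemma measurable_Rintegral_snd h : measurable_fun setT h ->
  measurable_fun setT (fun x => \int[m2]_y h (x, y)).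
Proof.
move=> mh; apply: (@measurableT_comp _ _ _ _ _ _ fine).
  exact: fine_measurable.
have mEh : measurable_fun setT (EFin \o h) by exact/measurable_EFinP.
rewrite (_ : (fun x => _) = fubini_F m2 ((EFin \o h)^\+)%E \-
    fubini_F m2 ((EFin \o h)^\-)%E)%E.
  by apply: emeasurable_funB; apply: measurable_fun_fubini_tonelli_F => //;
    [exact: measurable_funepos|exact: measurable_funeneg].
apply/funext => x; rewrite integralE; congr (_ - _)%E; apply: eq_integral => y _.
  by rewrite !funeposE.
by rewrite !funenegE.
Qed.

Lemma measurable_Rintegral_fst h : measurable_fun setT h ->
  measurable_fun setT (fun y => \int[m1]_x h (x, y)).
Proof.
move=> mh; apply: (@measurableT_comp _ _ _ _ _ _ fine).
  exact: fine_measurable.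
have mEh : measurable_fun setT (EFin \o h) by exact/measurable_EFinP.
rewrite (_ : (fun y => _) = fubini_G m1 ((EFin \o h)^\+)%E \-
    fubini_G m1 ((EFin \o h)^\-)%E)%E.
  by apply: emeasurable_funB; apply: measurable_fun_fubini_tonelli_G => //;
    [exact: measurable_funepos|exact: measurable_funeneg].
apply/funext => y; rewrite integralE; congr (_ - _)%E; apply: eq_integral => x _.
  by rewrite !funeposE.
by rewrite !funenegE.
Qed.

(** The real inner integral hides infinite values behind [fine], but by Fubini they occur only on a
    null set. *)
Lemma Rintegral21_prod_meas1 h : (m1 \x m2)%E.-integrable setT (EFin \o h) ->
  \int[m2]_y \int[m1]_x h (x, y) = \int[(m1 \x m2)%E]_z h z.
Proof.
move=> ih; have /integrableP[/measurable_EFinP mh _] := ih.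
rewrite /Rintegral; congr fine; rewrite -integral21_prod_meas1//.
apply: ae_eq_integral => //.
- exact/measurable_EFinP/measurable_Rintegral_fst.
- exact: (measurable_fubini_G ih).
have := ae_integrable2 ih; apply: filterS => y iy _.
by rewrite /= fineK//; exact: (integrable_fin_num measurableT iy).
Qed.

End iterated_Rintegral.

Section kernel.
Context d1 d2 (Y : measurableType d1) (S : measurableType d2) {R : realType}.
Variables (mu : {finite_measure set Y -> \bar R})
  (sigma : {finite_measure set S -> \bar R}).
Implicit Types (f g : Y * S -> R[i]) (q p : Y -> R[i]) (phi : S -> R[i]).

Local Notation pm := (mu \x sigma)%E.

(** A function of the first variable alone picks up the mass of the second factor; for the sphere
    this mass is its area. *)
Lemma L2_fst q : L2 mu setT q -> L2 pm setT (fun z => q z.1) /\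
  sqnorm pm (fun z => q z.1) = fine (sigma setT) * sqnorm mu q.
Proof.
move=> Lq; have mq1 : cmeasurable setT (fun z : Y * S => q z.1).
  by apply: cmeasurableT_comp Lq.1 _.
have E : (\int[pm]_z (modulus (q z.1) ^+ 2)%:E =
    (fine (sigma setT))%:E * \int[mu]_y (modulus (q y) ^+ 2)%:E)%E.
  rewrite fubini_tonelli1/=; last 2 first.
  - exact/measurable_EFinP/measurable_sqr_modulus.
  - by move=> z; rewrite lee_fin sqr_ge0.
  rewrite -ge0_integralZl//=; last 3 first.
  - exact/measurable_EFinP/measurable_sqr_modulus/Lq.1.
  - by move=> y _; rewrite lee_fin sqr_ge0.
  - by rewrite lee_fin fine_ge0.
  apply: eq_integral => y _; rewrite /fubini_F /= integral_cst//= muleC fineK//.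
  exact: fin_num_measure.
have qfin : (\int[mu]_y (modulus (q y) ^+ 2)%:E)%E \is a fin_num.
  rewrite ge0_fin_numE ?Lq.2//; apply: integral_ge0 => y _.
  by rewrite lee_fin sqr_ge0.
split; first by split=> //; rewrite E -(fineK qfin) -EFinM ltry.
by rewrite /sqnorm/Rintegral E -{1}(fineK qfin) -EFinM.
Qed.

(** The integrand for one fixed observation direction: [q] and [p] stand for the normal derivative
    and the values of [Phi_inf], [phi] for [phi_z]. *)
Definition kernel f g q p phi : Y * S -> R[i] :=
  fun z => (f z * q z.1 - g z * p z.1) * phi z.2.

Section bound.
Variables (f g : Y * S -> R[i]) (q p : Y -> R[i]) (phi : S -> R[i]).
Hypotheses (Lf : L2 pm setT f) (Lg : L2 pm setT g)
  (Lq : L2 mu setT q) (Lp : L2 mu setT p)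
  (mphi : cmeasurable setT phi) (phi1 : forall s, modulus (phi s) <= 1).

(** An AM-GM majorant of twice the kernel's modulus for every [t > 0]; the free parameter later
    turns the integrated bound into Cauchy-Schwarz. *)
Let dom t z := t * (modulus (f z) ^+ 2 + modulus (g z) ^+ 2) +
  t^-1 * (modulus (q z.1) ^+ 2 + modulus (p z.1) ^+ 2).

Let idom t : pm.-integrable setT (EFin \o dom t).
Proof.
apply: integrable_addr => //; apply: integrable_mull => //;
  apply: integrable_addr => //; apply: L2_integrable => //.
- exact: (L2_fst Lq).1.
- exact: (L2_fst Lp).1.
Qed.

Let int_dom t : \int[pm]_z dom t z = t * (sqnorm pm f + sqnorm pm g) +
  t^-1 * (fine (sigma setT) * (sqnorm mu q + sqnorm mu p)).
Proof.
have If := L2_integrable Lf; have Ig := L2_integrable Lg.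
have Iq := L2_integrable (L2_fst Lq).1; have Ip := L2_integrable (L2_fst Lp).1.
have Ifg := integrable_addr measurableT If Ig.
have Iqp := integrable_addr measurableT Iq Ip.
rewrite RintegralD//; [|exact: integrable_mull|exact: integrable_mull].
rewrite !RintegralZl// !RintegralD//.
by rewrite (mulrDr (fine _)) -(L2_fst Lq).2 -(L2_fst Lp).2//.
Qed.

Let kernel_dom t z : 0 < t -> 2 * modulus (kernel f g q p phi z) <= dom t z.
Proof.
move=> t0; rewrite /kernel modulusM.
have : modulus (f z * q z.1 - g z * p z.1) * modulus (phi z.2) <=
  modulus (f z) * modulus (q z.1) + modulus (g z) * modulus (p z.1).
  rewrite (le_trans (ler_piMr (modulus_ge0 _) (phi1 _)))//.
  by rewrite (le_trans (ler_modulusB _ _))// !modulusM.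
rewrite /dom; set a := modulus (f z); set b := modulus (g z).
set c := modulus (q z.1); set e := modulus (p z.1) => H.
have amgm (u v : R) : 2 * (u * v) <= t * u ^+ 2 + t^-1 * v ^+ 2.
  rewrite -subr_ge0.
  rewrite (_ : _ - _ = t^-1 * (t * u - v) ^+ 2); last by field; lra.
  by rewrite mulr_ge0// ?invr_ge0 ?sqr_ge0// ltW.
have := amgm a c; have := amgm b e; lra.
Qed.

Lemma cmeasurable_kernel : cmeasurable setT (kernel f g q p phi).
Proof.
apply: cmeasurableM; last exact: (cmeasurableT_comp mphi).
apply: cmeasurableB; (apply: cmeasurableM; first by [case: Lf|case: Lg]).
- exact: (cmeasurableT_comp Lq.1).
- exact: (cmeasurableT_comp Lp.1).
Qed.

Lemma cintegrable_kernel : cintegrable pm (kernel f g q p phi).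
Proof.
apply: (cintegrable_le cmeasurable_kernel (idom 1)) => z.
have := kernel_dom z ltr01; have := modulus_ge0 (kernel f g q p phi z); lra.
Qed.

Lemma kernel_bound : modulus (cintegral pm setT (kernel f g q p phi)) ^+ 2 <=
  (sqnorm pm f + sqnorm pm g) * (fine (sigma setT) * (sqnorm mu q + sqnorm mu p)).
Proof.
apply: sqr_le_of_amgm; first exact: modulus_ge0.
  by rewrite addr_ge0 ?sqnorm_ge0.
  by rewrite mulr_ge0 ?addr_ge0 ?sqnorm_ge0// fine_ge0.
move=> t t0; rewrite -int_dom.
have ih : pm.-integrable setT (EFin \o (fun z => 2^-1 * dom t z)).
  exact: integrable_mull.
have le z : modulus (kernel f g q p phi z) <= 2^-1 * dom t z.
  by rewrite ler_pdivlMl// kernel_dom.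
have := modulus_cintegral_le cintegrable_kernel ih le.
by rewrite RintegralZl// ler_pdivlMl.
Qed.

End bound.

(* Fubini only gives the inner integral for almost every direction, so the two
   sides are compared through a.e. equal measurable integrands. *)
Lemma cintegral_kernel f g q p phi : L2 pm setT f -> L2 pm setT g ->
  L2 mu setT q -> L2 mu setT p -> cmeasurable setT phi ->
  (forall s, modulus (phi s) <= 1) ->
  cintegral sigma setT (fun d => cintegral mu setT
    (fun y => f (y, d) * q y - g (y, d) * p y) * phi d) =
  cintegral pm setT (kernel f g q p phi).
Proof.
move=> Lf Lg Lq Lp mphi phi1.
(* The case [phi = 1] supplies what the inner integral needs before the phase is attached:
   measurability in [d], and integrability in [y] for almost every [d], which lets the factor
   [phi d] move inside. *)
pose one : S -> R[i] := cst 1.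
have mone : cmeasurable setT one by split; exact: measurable_cst.
have one1 s : modulus (one s) <= 1.
  by rewrite /modulus /one /= expr1n expr0n addr0 sqrtr1.
have [KR KI] := cintegrable_kernel Lf Lg Lq Lp mone one1.
have [HR HI] := cintegrable_kernel Lf Lg Lq Lp mphi phi1.
pose W d := cintegral mu setT (fun y => f (y, d) * q y - g (y, d) * p y).
have WE : {ae sigma, forall d, W d * phi d =
    cintegral mu setT (fun y => kernel f g q p phi (y, d))}.
  have := ae_integrable2 KR; have := ae_integrable2 KI.
  apply: filterS2 => d KId KRd; rewrite /kernel /W/=.
  rewrite -cintegralZr//; split.
  - move: KRd; apply: eq_integrable => // y _.
    by rewrite /= /kernel mulr1.
  - move: KId; apply: eq_integrable => // y _.
    by rewrite /= /kernel mulr1.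
have mW : cmeasurable setT W.
  have [mR mI] := cmeasurable_kernel Lf Lg Lq Lp mone.
  split.
    rewrite (_ : (fun d => _) = fun d =>
      \int[mu]_y complex.Re (kernel f g q p one (y, d))).
      exact: (measurable_Rintegral_fst mu
      (h := fun z => complex.Re (kernel f g q p one z)) mR).
    by apply/funext => d; apply: eq_Rintegral => y _; rewrite /kernel mulr1.
  rewrite (_ : (fun d => _) = fun d =>
      \int[mu]_y complex.Im (kernel f g q p one (y, d))).
    exact: (measurable_Rintegral_fst mu
      (h := fun z => complex.Im (kernel f g q p one z)) mI).
  by apply/funext => d; apply: eq_Rintegral => y _; rewrite /kernel mulr1.
have [mWR mWI] := cmeasurableM mW mphi.
have [mR mI] := cmeasurable_kernel Lf Lg Lq Lp mphi.
rewrite /cintegral; congr (_ +i* _).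
- rewrite -(Rintegral21_prod_meas1 HR); congr fine; apply: ae_eq_integral => //.
  + exact/measurable_EFinP.
  + apply/measurable_EFinP; exact: (measurable_Rintegral_fst mu
      (h := fun z => complex.Re (kernel f g q p phi z)) mR).
  + by apply: filterS WE => d -> _.
- rewrite -(Rintegral21_prod_meas1 HI); congr fine; apply: ae_eq_integral => //.
  + exact/measurable_EFinP.
  + apply/measurable_EFinP; exact: (measurable_Rintegral_fst mu
      (h := fun z => complex.Im (kernel f g q p phi z)) mI).
  + by apply: filterS WE => d -> _.
Qed.

End kernel.

Lemma Rintegral12_prod_meas1 d1 d2 (T1 : measurableType d1)
    (T2 : measurableType d2) (R : realType)
    (m1 : {sigma_finite_measure set T1 -> \bar R})
    (m2 : {sigma_finite_measure set T2 -> \bar R}) (h : T1 * T2 -> R) :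
  (forall x, m2.-integrable setT (EFin \o (fun y => h (x, y)))) ->
  (m1 \x m2)%E.-integrable setT (EFin \o h) ->
  m1.-integrable setT (EFin \o (fun x => \int[m2]_y h (x, y))) /\
  \int[m1]_x \int[m2]_y h (x, y) = \int[(m1 \x m2)%E]_z h z.
Proof.
move=> hx ih.
have E : EFin \o (fun x => \int[m2]_y h (x, y)) = fubini_F m2 (EFin \o h).
  apply/funext => x; rewrite /= /Rintegral fineK//.
  exact: (integrable_fin_num measurableT (hx x)).
split; first by rewrite E; exact: integrable_fubini_F ih.
rewrite {1}/Rintegral [X in integral _ _ X](_ : _ = fubini_F m2 (EFin \o h))//.
by rewrite (integral12_prod_meas1 ih).
Qed.

Lemma ler_dist_sqr (R : realFieldType) (a b e B t : R) :
  0 <= a -> 0 <= b -> 0 <= t -> 0 <= B -> `|a - b| <= e ->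
  a ^+ 2 <= B -> e ^+ 2 <= t ^+ 2 * B ->
  `|a ^+ 2 - b ^+ 2| <= B * (2 * t + t ^+ 2).
Proof.
move=> a0 b0 t0 B0 abe aB eB.
have e0 : 0 <= e by exact: le_trans (normr_ge0 _) abe.
(* The cross term is compared through squares: [e ^+ 2 * a ^+ 2 <= t ^+ 2 * B * B]. *)
have ea : e * a <= t * B.
  rewrite -(ler_pXn2r (n := 2)) ?nnegrE ?mulr_ge0// !exprMn.
  rewrite (le_trans (ler_wpM2r (sqr_ge0 a) eB))//.
  by rewrite -mulrA expr2 ler_wpM2l ?sqr_ge0// ler_wpM2l.
rewrite subr_sqr normrM (ger0_norm (addr_ge0 a0 b0)).
have : b <= a + e by move: abe; rewrite ler_norml => /andP[]; lra.
move=> bae; rewrite (le_trans (ler_wpM2r (addr_ge0 a0 b0) abe))//.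
rewrite (@le_trans _ _ (e * (2 * a + e)))//; first by rewrite ler_wpM2l//; lra.
by rewrite mulrDr -expr2; lra.
Qed.

Lemma fin_num_product_measure1 d1 d2 (T1 : measurableType d1)
    (T2 : measurableType d2) (R : realType)
    (m1 : {finite_measure set T1 -> \bar R})
    (m2 : {finite_measure set T2 -> \bar R}) : fin_num_fun (m1 \x m2)%E.
Proof.
move=> A mA; rewrite ge0_fin_numE//.
apply: (@le_lt_trans _ _ ((m1 \x m2)%E (setT `*` setT))).
  by apply: le_measure; rewrite ?inE//; exact: measurableX.
by rewrite product_measure1E// lte_mul_pinfty// -?ge0_fin_numE// fin_num_measure.
Qed.

Section functional.
Context d1 d2 (Y : measurableType d1) (S : measurableType d2) {R : realType}.
Variables (mu : {finite_measure set Y -> \bar R})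
  (sigma : {finite_measure set S -> \bar R}).

Local Notation pm := (mu \x sigma)%E.
Local Notation qm := (sigma \x mu)%E.

(** The inner double integral of the indicator, on whole spaces; [Q] and [P] are the normal
    derivative and the values of [Phi_inf], with the observation direction as first argument. *)
Definition transform (Q P : S * Y -> R[i]) (phi : S -> R[i])
    (f g : Y * S -> R[i]) (x : S) : R[i] :=
  cintegral sigma setT (fun d => cintegral mu setT
    (fun y => f (y, d) * Q (x, y) - g (y, d) * P (x, y)) * phi d).

Variables (Q P : S * Y -> R[i]) (phi : S -> R[i]).
Hypotheses (LQ : L2 qm setT Q) (LP : L2 qm setT P)
  (LQx : forall x, L2 mu setT (fun y => Q (x, y)))
  (LPx : forall x, L2 mu setT (fun y => P (x, y)))
  (mphi : cmeasurable setT phi) (phi1 : forall s, modulus (phi s) <= 1).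

Lemma transformE f g x : L2 pm setT f -> L2 pm setT g ->
  transform Q P phi f g x = cintegral pm setT
    (kernel f g (fun y => Q (x, y)) (fun y => P (x, y)) phi).
Proof. by move=> Lf Lg; exact: cintegral_kernel. Qed.

(** As a single integral over [Y * S], the transform is measurable in [x] by Tonelli on
    [S * (Y * S)]. For this the product measure is repackaged as a finite measure [pm']. *)
Lemma cmeasurable_transform f g : L2 pm setT f -> L2 pm setT g ->
  cmeasurable setT (transform Q P phi f g).
Proof.
move=> Lf Lg.
pose K (w : S * (Y * S)) : R[i] :=
  (f w.2 * Q (w.1, w.2.1) - g w.2 * P (w.1, w.2.1)) * phi w.2.2.
have mK : cmeasurable setT K.
  have mxy : measurable_fun setT (fun w : S * (Y * S) => (w.1, w.2.1)).
    apply/measurable_fun_pair => //; exact: measurableT_comp.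
  apply: cmeasurableM; last first.
    by apply: (cmeasurableT_comp mphi); exact: measurableT_comp.
  apply: cmeasurableB; apply: cmeasurableM.
  - exact: (cmeasurableT_comp Lf.1).
  - exact: (cmeasurableT_comp LQ.1).
  - exact: (cmeasurableT_comp Lg.1).
  - exact: (cmeasurableT_comp LP.1).
have [mR mI] := mK.
pose pm' : {finite_measure set (Y * S)%type -> \bar R} :=
  HB.pack (product_measure1 mu sigma)
    (Measure_isFinite.Build _ _ _ pm (fin_num_product_measure1 mu sigma)).
split.
- have := measurable_Rintegral_snd pm' (h := fun w => complex.Re (K w)) mR.
  by congr measurable_fun; apply/funext => x; rewrite transformE.
- have := measurable_Rintegral_snd pm' (h := fun w => complex.Im (K w)) mI.
  by congr measurable_fun; apply/funext => x; rewrite transformE.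
Qed.

Lemma transformB f g f' g' x : L2 pm setT f -> L2 pm setT g ->
  L2 pm setT f' -> L2 pm setT g' ->
  transform Q P phi f g x - transform Q P phi f' g' x =
  transform Q P phi (fun z => f z - f' z) (fun z => g z - g' z) x.
Proof.
move=> Lf Lg Lf' Lg'; rewrite !transformE//; [|exact: L2B|exact: L2B].
rewrite -cintegralB; [|exact: cintegrable_kernel|exact: cintegrable_kernel].
by congr cintegral; apply/funext => z; rewrite /kernel; ring.
Qed.

Lemma transform_bound f g x : L2 pm setT f -> L2 pm setT g ->
  modulus (transform Q P phi f g x) ^+ 2 <= (sqnorm pm f + sqnorm pm g) *
    (fine (sigma setT) *
      (sqnorm mu (fun y => Q (x, y)) + sqnorm mu (fun y => P (x, y)))).
Proof. by move=> Lf Lg; rewrite transformE//; exact: kernel_bound. Qed.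

Let N x : R := sqnorm mu (fun y => Q (x, y)) + sqnorm mu (fun y => P (x, y)).

Let NP : sigma.-integrable setT (EFin \o N) /\
  \int[sigma]_x N x = sqnorm qm Q + sqnorm qm P.
Proof.
have [iQ EQ] := Rintegral12_prod_meas1 (h := fun z => modulus (Q z) ^+ 2)
  (fun x => L2_integrable (LQx x)) (L2_integrable LQ).
have [iP EP] := Rintegral12_prod_meas1 (h := fun z => modulus (P z) ^+ 2)
  (fun x => L2_integrable (LPx x)) (L2_integrable LP).
by split; [exact: integrable_addr|rewrite RintegralD// EQ EP].
Qed.

Lemma transform_stability f g f' g' (t : R) : 0 <= t ->
  L2 pm setT f -> L2 pm setT g -> L2 pm setT f' -> L2 pm setT g' ->
  sqnorm pm (fun z => f z - f' z) + sqnorm pm (fun z => g z - g' z) <=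
    t ^+ 2 * (sqnorm pm f + sqnorm pm g) ->
  `|\int[sigma]_x modulus (transform Q P phi f g x) ^+ 2 -
    \int[sigma]_x modulus (transform Q P phi f' g' x) ^+ 2| <=
  fine (sigma setT) * (sqnorm qm Q + sqnorm qm P) *
    (sqnorm pm f + sqnorm pm g) * (2 * t + t ^+ 2).
Proof.
move=> t0 Lf Lg Lf' Lg' ft.
have [iN EN] := NP.
have s0 : 0 <= fine (sigma setT) by rewrite fine_ge0.
have N0 x : 0 <= N x by rewrite addr_ge0// sqnorm_ge0.
have U0 f1 g1 : 0 <= sqnorm pm f1 + sqnorm pm g1 by rewrite addr_ge0// sqnorm_ge0.
have iA f1 g1 : L2 pm setT f1 -> L2 pm setT g1 -> sigma.-integrable setT
    (EFin \o (fun x => modulus (transform Q P phi f1 g1 x) ^+ 2)).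
  move=> Lf1 Lg1.
  apply: (le_integrable measurableT _ _ (integrable_mull
     ((sqnorm pm f1 + sqnorm pm g1) * fine (sigma setT)) measurableT iN)).
    exact/measurable_EFinP/measurable_sqr_modulus/cmeasurable_transform.
  move=> x _; rewrite lee_fin ger0_norm ?sqr_ge0// (le_trans _ (ler_norm _))//.
  by rewrite /= -mulrA transform_bound.
rewrite -RintegralB//; [|exact: iA|exact: iA].
rewrite -EN.
have -> : fine (sigma setT) * (\int[sigma]_x N x) * (sqnorm pm f + sqnorm pm g) *
    (2 * t + t ^+ 2) = \int[sigma]_x (((sqnorm pm f + sqnorm pm g) *
      fine (sigma setT) * (2 * t + t ^+ 2)) * N x).
  by rewrite RintegralZl//; ring.
have iB : sigma.-integrable setT (EFin \o (fun x =>
    modulus (transform Q P phi f g x) ^+ 2 - modulus (transform Q P phi f' g' x) ^+ 2)).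
  by have := integrableB measurableT (iA _ _ Lf Lg) (iA _ _ Lf' Lg').
rewrite (le_trans (le_normr_Rintegral _ iB))//.
apply: le_Rintegral => //.
- exact: (integrable_norm iB).
- exact: integrable_mull.
move=> x _.
have -> : (sqnorm pm f + sqnorm pm g) * fine (sigma setT) * (2 * t + t ^+ 2) * N x =
   ((sqnorm pm f + sqnorm pm g) * (fine (sigma setT) * N x)) * (2 * t + t ^+ 2) by ring.
apply: (@ler_dist_sqr _ _ _
  (modulus (transform Q P phi f g x - transform Q P phi f' g' x))) => //.
- exact: modulus_ge0.
- exact: modulus_ge0.
- by rewrite !mulr_ge0.
- exact: ler_dist_modulus.
- exact: transform_bound.
- rewrite transformB//.
  apply: (le_trans (transform_bound _ (L2B Lf Lf') (L2B Lg Lg'))).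
  by rewrite [leRHS]mulrA ler_wpM2r//; exact: (mulr_ge0 s0 (N0 x)).
Qed.

End functional.

(** * Extension by zero, and the stability estimate over subsets *)

Section zero_extension.
Context d (T : measurableType d) {R : realType} (m : {measure set T -> \bar R}).
Implicit Types (A : set T) (f : T -> R[i]).

Definition zext A f : T -> R[i] := patch (cst 0) A f.

Lemma zext_in A f x : A x -> zext A f x = f x.
Proof. by move=> Ax; rewrite /zext patchT ?inE. Qed.

Lemma zext_out A f x : ~ A x -> zext A f x = 0.
Proof. by move=> Ax; rewrite /zext patchC// in_setE. Qed.

Lemma Re_zext A f : (fun x => complex.Re (zext A f x)) =
  (fun x => complex.Re (f x)) \_ A.
Proof. by apply/funext => x; rewrite /zext /patch; case: ifP. Qed.

Lemma Im_zext A f : (fun x => complex.Im (zext A f x)) =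
  (fun x => complex.Im (f x)) \_ A.
Proof. by apply/funext => x; rewrite /zext /patch; case: ifP. Qed.

Lemma cmeasurable_zext A f : measurable A -> cmeasurable A f ->
  cmeasurable setT (zext A f).
Proof.
move=> mA [mR mI]; split.
  by rewrite Re_zext; apply/measurable_restrict => //; rewrite setTI.
by rewrite Im_zext; apply/measurable_restrict => //; rewrite setTI.
Qed.

Lemma cintegral_zext A f : cintegral m A f = cintegral m setT (zext A f).
Proof. by rewrite /cintegral Re_zext Im_zext -!Rintegral_mkcond. Qed.

Lemma integral_sqr_zext A f : (\int[m]_(x in A) (modulus (f x) ^+ 2)%:E =
  \int[m]_x (modulus (zext A f x) ^+ 2)%:E)%E.
Proof.
rewrite integral_mkcond; apply: eq_integral => x _.
rewrite /zext /patch; case: ifP => // _.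
by rewrite sqr_modulus/= expr0n/= addr0.
Qed.

Lemma L2_zext A f : measurable A -> L2 m A f -> L2 m setT (zext A f).
Proof.
move=> mA [mf foo]; split; first exact: cmeasurable_zext.
by rewrite -integral_sqr_zext.
Qed.

Lemma sqnorm_zext A f : sqnorm m (zext A f) = L2norm m A f ^+ 2.
Proof.
rewrite /L2norm integral_sqr_zext sqr_sqrtr// fine_ge0// integral_ge0// => x _.
by rewrite lee_fin sqr_ge0.
Qed.

Lemma zextB A f g x : zext A (fun x => f x - g x) x = zext A f x - zext A g x.
Proof. by rewrite /zext /patch; case: ifP => //; rewrite subr0. Qed.

End zero_extension.

Section stability.
Context d1 d2 (Y : measurableType d1) (S : measurableType d2) {R : realType}.
Variables (mu : {finite_measure set Y -> \bar R})
  (sigma : {finite_measure set S -> \bar R}) (B : set Y) (D : set S).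
Hypotheses (mB : measurable B) (mD : measurable D).
Variables (Q P : S -> Y -> R[i]) (phi : S -> R[i]).
Hypotheses (LQ : L2 (sigma \x mu)%E (D `*` B) (fun p => Q p.1 p.2))
  (LP : L2 (sigma \x mu)%E (D `*` B) (fun p => P p.1 p.2))
  (LQx : forall x, D x -> L2 mu B (Q x)) (LPx : forall x, D x -> L2 mu B (P x))
  (mphi : cmeasurable D phi) (phi1 : forall s, D s -> modulus (phi s) <= 1).
Implicit Types f g : Y -> S -> R[i].

(** [indicator] is the case [B := bdry Omega], [D := sphere], [Q := dnu_Phi_inf nu k],
    [P := Phi_inf k], [phi := phi_z k z]. *)
Definition energy f g : R :=
  \int[sigma]_(x in D) modulus (cintegral sigma D (fun d =>
    cintegral mu B (fun y => f y d * Q x y - g y d * P x y) * phi d)) ^+ 2.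

Let Q' := zext (D `*` B) (fun p => Q p.1 p.2).
Let P' := zext (D `*` B) (fun p => P p.1 p.2).
Let ext f := zext (B `*` D) (fun p => f p.1 p.2).

(** The whole-space lemmas ask for square-integrable rows at every [x]; outside [D] the row is
    identically zero. *)
Let ext_row (K : S -> Y -> R[i]) x : (forall x, D x -> L2 mu B (K x)) ->
  L2 mu setT (fun y => zext (D `*` B) (fun p => K p.1 p.2) (x, y)).
Proof.
move=> LK; have [Dx|Dx] := pselect (D x).
  rewrite (_ : (fun y => _) = zext B (K x)); first exact/L2_zext/LK.
  apply/funext => y; have [By|By] := pselect (B y); first by rewrite !zext_in.
  by rewrite !zext_out// => -[].
rewrite (_ : (fun y => _) = cst 0).
  split; first by split; exact: measurable_cst.
  by under eq_integral do rewrite sqr_modulus/= expr0n/= addr0; rewrite integral0.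
by apply/funext => y; rewrite zext_out// => -[].
Qed.

Let energyE f g : energy f g = \int[sigma]_x
  modulus (transform mu sigma Q' P' (zext D phi) (ext f) (ext g) x) ^+ 2.
Proof.
rewrite /energy Rintegral_mkcond; apply: eq_Rintegral => x _.
rewrite /patch; case: ifPn => [/set_mem|/negP + ]; last rewrite in_setE; move=> Dx.
  congr (modulus _ ^+ 2); rewrite cintegral_zext; congr cintegral.
  apply/funext => d; have [Dd|Dd] := pselect (D d); last first.
    by rewrite !(zext_out _ Dd) mulr0.
  rewrite !(zext_in _ Dd) cintegral_zext; congr (cintegral _ _ _ * _).
  apply/funext => y; have [By|By] := pselect (B y); last first.
    by rewrite /Q' /P' !zext_out ?mulr0 ?subr0// => -[].
  by rewrite /ext /Q' /P' !zext_in.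
(* For [x] outside [D] both extended kernels vanish, matching the default value 0 of the restricted
   outer integrand. *)
rewrite /transform [X in cintegral sigma _ X](_ : _ = cst 0).
  rewrite sqr_modulus /cintegral/= Rintegral_cst// mul0r expr0n/= addr0//.
apply/funext => d; rewrite [X in cintegral mu _ X](_ : _ = cst 0).
  by rewrite /cintegral/= Rintegral_cst// mul0r mul0r.
by apply/funext => y; rewrite /Q' /P' !zext_out ?mulr0 ?subr0// => -[].
Qed.

Theorem energy_stability f g f' g' (t : R) : 0 <= t ->
  L2 (mu \x sigma)%E (B `*` D) (fun p => f p.1 p.2) ->
  L2 (mu \x sigma)%E (B `*` D) (fun p => g p.1 p.2) ->
  L2 (mu \x sigma)%E (B `*` D) (fun p => f' p.1 p.2) ->
  L2 (mu \x sigma)%E (B `*` D) (fun p => g' p.1 p.2) ->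
  L2norm (mu \x sigma)%E (B `*` D) (fun p => f p.1 p.2 - f' p.1 p.2) <=
    t * L2norm (mu \x sigma)%E (B `*` D) (fun p => f p.1 p.2) ->
  L2norm (mu \x sigma)%E (B `*` D) (fun p => g p.1 p.2 - g' p.1 p.2) <=
    t * L2norm (mu \x sigma)%E (B `*` D) (fun p => g p.1 p.2) ->
  `|energy f g - energy f' g'| <=
  fine (sigma setT) *
    (L2norm (sigma \x mu)%E (D `*` B) (fun p => Q p.1 p.2) ^+ 2 +
     L2norm (sigma \x mu)%E (D `*` B) (fun p => P p.1 p.2) ^+ 2) *
    (L2norm (mu \x sigma)%E (B `*` D) (fun p => f p.1 p.2) ^+ 2 +
     L2norm (mu \x sigma)%E (B `*` D) (fun p => g p.1 p.2) ^+ 2) *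
    (2 * t + t ^+ 2).
Proof.
move=> t0 Lf Lg Lf' Lg' ff gg.
have mBD : measurable (B `*` D) by exact: measurableX.
have mDB : measurable (D `*` B) by exact: measurableX.
rewrite !energyE.
have sq (a b : R) : 0 <= a -> a <= t * b -> a ^+ 2 <= t ^+ 2 * b ^+ 2.
  move=> a0 ab; rewrite -exprMn ler_pXn2r ?nnegrE//.
  exact: le_trans ab.
have Lext h : L2 (mu \x sigma)%E (B `*` D) (fun p => h p.1 p.2) ->
  L2 (mu \x sigma)%E setT (ext h) by move=> Lh; exact: L2_zext.
have LK K : L2 (sigma \x mu)%E (D `*` B) (fun p => K p.1 p.2) ->
  L2 (sigma \x mu)%E setT (zext (D `*` B) (fun p => K p.1 p.2))
  by move=> ?; exact: L2_zext.
have phi1' s : modulus (zext D phi s) <= 1.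
  have [Ds|Ds] := pselect (D s); first by rewrite zext_in// phi1.
  by rewrite zext_out// /modulus ComplexField.Normc.normc0.
have := @transform_stability _ _ _ _ _ mu sigma Q' P' (zext D phi) (LK _ LQ) (LK _ LP)
  (fun x => ext_row x LQx) (fun x => ext_row x LPx) (cmeasurable_zext mD mphi) phi1'
  (ext f) (ext g) (ext f') (ext g') t t0
  (Lext _ Lf) (Lext _ Lg) (Lext _ Lf') (Lext _ Lg').
rewrite /Q' /P' !sqnorm_zext; apply.
under [X in sqnorm _ X]eq_fun do rewrite -zextB.
under [X in _ + sqnorm _ X]eq_fun do rewrite -zextB.
by rewrite !sqnorm_zext mulrDr; apply: lerD; apply: sq => //; exact: sqrtr_ge0.
Qed.

End stability.

(** * Hausdorff measure *)

Section metric_outer_measure.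
Local Open Scope ereal_scope.
Context {R : realType} {T : Type} (mu : {outer_measure set T -> \bar R}).
Variable h : T -> R.
Hypothesis mu_separated : forall (s t : R) X Y, (s < t)%R ->
  X `<=` [set x | h x <= s]%R -> Y `<=` [set x | t <= h x]%R ->
  mu X + mu Y <= mu (X `|` Y).

(* Caratheodory's criterion: the layers between a + 1/(k+2) and a + 1/(k+1)
   have summable measure, because every other layer is at positive distance. *)
Lemma caratheodory_sublevel (a : R) : mu.-caratheodory [set x | h x <= a]%R.
Proof.
have mu0 A : 0 <= mu A := outer_measure_ge0 mu A.
apply: le_caratheodory_measurable => X.
have [->|Xfin] := eqVneq (mu X) +oo; first by rewrite leey.
have {Xfin}Xoo : mu X < +oo by rewrite ltey.
pose u k : R := (a + k.+1%:R^-1)%R.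
have u_dec j k : (j < k)%N -> (u k < u j)%R.
  by move=> jk; rewrite ltrD2l ltf_pV2 ?posrE ?ltr0n// ltr_nat.
have au k : (a < u k)%R by rewrite ltrDl invr_gt0.
pose A k := X `&` [set x | u k <= h x]%R.
pose L k := X `&` [set x | u k.+1 <= h x < u k]%R.
set G := X `&` ~` _.
have AX k : mu (A k) <= mu X by apply: le_outer_measure; exact: subIsetl.
(* [L k.+1] lies below [u k.+1] and [A k] above [u k], a positive gap, and both sets are inside
   [A k.+2]. *)
have step k : mu (L k.+1) + mu (A k) <= mu (A k.+2).
  apply: (le_trans (@mu_separated (u k.+1) (u k) _ _ _ _ _)).
  - exact: u_dec.
  - by move=> x [_ /andP[_ /ltW]].
  - by move=> x [].
  - apply: le_outer_measure => x [[Xx /= /andP[ux _]]|[Xx /= ux]]; split => //=.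
    by rewrite (le_trans _ ux)// ltW// u_dec.
(* Two consecutive sets on the right let one induction handle the even and the odd layers
   together. *)
have sumL N : \sum_(0 <= k < N) mu (L k.+1) <= mu (A N) + mu (A N.+1).
  elim: N => [|N IH]; first by rewrite big_geq// adde_ge0//; exact: outer_measure_ge0.
  rewrite big_nat_recr//= (le_trans (leeD2r _ IH))//.
  by rewrite addeC addeA addeC leeD2l// step.
have sumLoo : \sum_(0 <= k <oo) mu (L k) < +oo.
  rewrite nneseries_recl// lte_add_pinfty//.
    by apply: le_lt_trans Xoo; apply: le_outer_measure; exact: subIsetl.
  apply: (@le_lt_trans _ _ (mu X + mu X)); last exact: lte_add_pinfty.
  rewrite -[1%N]add1n -(nneseries_addn (f := fun k => mu (L k)))//.
  apply: lime_le; first exact: is_cvg_nneseries.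
  apply: nearW => N; under eq_bigr do rewrite addn1.
  by rewrite (le_trans (sumL N))// leeD.
(* The part of [X] above [a] lies in [A N], which is separated from the sublevel set, together with
   a tail of layers whose total measure vanishes as [N] grows. *)
have bound N : mu (X `&` [set x | h x <= a]%R) + mu G <=
    mu X + \sum_(N <= k <oo) mu (L k).
  have GA : G `<=` A N `|` \bigcup_(k in ~` `I_N) L k.
    move=> x [Xx /= /negP]; rewrite -ltNge => ax.
    have [ux|xu] := leP (u N) (h x); [by left|right].
    have [k Nk ukx] : exists2 k, (N <= k)%N & (u k.+1 <= h x < u k)%R.
      have [k kx] : exists k, (u k <= h x)%R.
        exists (Num.truncn (h x - a)^-1); rewrite -lerBrDl.
        rewrite -[leRHS]invrK lef_pV2 ?posrE ?ltr0n ?invr_gt0 ?subr_gt0//.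
        by rewrite ltW// truncnS_gt.
      elim: k kx => [|k IH] kx.
        have : (u N <= u 0)%R.
          by case: N {xu} => // N; rewrite ltW// u_dec.
        by move/(lt_le_trans xu); rewrite ltNge kx.
      have [|xk] := leP (u k) (h x); first exact: IH.
      exists k; last by rewrite kx xk.
      rewrite leqNgt; apply/negP => kN.
      have : (u N <= u k.+1)%R.
        by move: kN; rewrite leq_eqVlt => /predU1P[->//|kN]; rewrite ltW// u_dec.
      by move/(lt_le_trans xu); rewrite ltNge kx.
    by exists k => //; rewrite /= ltnNge Nk.
  rewrite (le_trans (leeD2l _ (le_outer_measure mu _ _ GA)))//.
  rewrite (le_trans (leeD2l _ (outer_measureU2 _ _ _)))//.
  rewrite addeA leeD//; last exact: outer_measure_sigma_subadditive_tail.
  apply: (le_trans (@mu_separated a (u N) _ _ (au N) _ _)).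
  - by move=> x [].
  - by move=> x [].
  - by apply: le_outer_measure => x [[]|[]].
have cv : (fun N => mu X + \sum_(N <= k <oo) mu (L k)) @ \oo --> mu X + 0.
  apply: cvgeD; last exact: nneseries_tail_cvg.
    by rewrite fin_num_adde_defl.
  exact: cvg_cst.
rewrite -[leRHS]adde0 -(cvg_lim _ cv)//; apply: lime_ge.
  by apply/cvg_ex; exists (mu X + 0).
exact: nearW.
Qed.

End metric_outer_measure.

(** * Euclidean inner product and norm *)

Section euclidean_facts.
Context {R : realType} {n : nat}.
Implicit Types (x y v : 'rV[R]_n).

Lemma dotC x y : dot x y = dot y x.
Proof. by apply: eq_bigr => i _; rewrite mulrC. Qed.

Lemma dotDl x y v : dot (x + y) v = dot x v + dot y v.
Proof. by rewrite -big_split; apply: eq_bigr => i _; rewrite mxE mulrDl. Qed.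

Lemma dotZl (a : R) x y : dot (a *: x) y = a * dot x y.
Proof. by rewrite mulr_sumr; apply: eq_bigr => i _; rewrite mxE mulrA. Qed.

Lemma dotNl x y : dot (- x) y = - dot x y.
Proof. by rewrite -scaleN1r dotZl mulN1r. Qed.

Lemma dotBl x y v : dot (x - y) v = dot x v - dot y v.
Proof. by rewrite dotDl dotNl. Qed.

Lemma dotZr (a : R) x y : dot x (a *: y) = a * dot x y.
Proof. by rewrite dotC dotZl dotC. Qed.

Lemma dotBr x y v : dot v (x - y) = dot v x - dot v y.
Proof. by rewrite dotC dotBl !(dotC v). Qed.

Lemma dot_ge0 x : 0 <= dot x x.
Proof. by apply: sumr_ge0 => i _; rewrite -expr2 sqr_ge0. Qed.

Lemma enorm_ge0 x : 0 <= enorm x. Proof. exact: sqrtr_ge0. Qed.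

Lemma sqr_enorm x : enorm x ^+ 2 = dot x x.
Proof. by rewrite sqr_sqrtr// dot_ge0. Qed.

Lemma enormN x : enorm (- x) = enorm x.
Proof. by rewrite /enorm dotNl dotC dotNl opprK. Qed.

Lemma enormZ (a : R) x : enorm (a *: x) = `|a| * enorm x.
Proof.
by rewrite /enorm dotZl dotZr mulrA -expr2 sqrtrM ?sqr_ge0// sqrtr_sqr.
Qed.

(** Nonnegativity of [dot v v] at [v = dot y y *: x - dot x y *: y] is the claim multiplied by
    [dot y y]. *)
Lemma sqr_dot_le x y : dot x y ^+ 2 <= dot x x * dot y y.
Proof.
have [y0|y0] := eqVneq (dot y y) 0.
  suff -> : dot x y = 0 by rewrite expr0n/= mulr_ge0// dot_ge0.
  rewrite /dot big1// => i _; suff -> : y ord0 i = 0 by rewrite mulr0.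
  have /eqP := y0; rewrite psumr_eq0; last by move=> j _; rewrite -expr2 sqr_ge0.
  move=> /allP/(_ i); rewrite mem_index_enum => /(_ isT).
  by rewrite mulf_eq0 orbb => /eqP.
have yp : 0 < dot y y by rewrite lt_neqAle eq_sym y0 dot_ge0.
have := dot_ge0 (dot y y *: x - dot x y *: y).
rewrite dotBl !dotBr !dotZl !dotZr (dotC y x) => H.
rewrite -(ler_pM2l yp); nra.
Qed.

Lemma normr_dot_le x y : `|dot x y| <= enorm x * enorm y.
Proof.
rewrite -(ler_pXn2r (n := 2)) ?nnegrE ?mulr_ge0 ?enorm_ge0//.
by rewrite real_normK ?num_real// exprMn !sqr_enorm sqr_dot_le.
Qed.

Lemma enormD x y : enorm (x + y) <= enorm x + enorm y.
Proof.
rewrite -(ler_pXn2r (n := 2)) ?nnegrE ?addr_ge0 ?enorm_ge0//.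
rewrite sqrrD !sqr_enorm dotDl (dotC x) (dotC y) !dotDl (dotC y x).
by have := le_trans (ler_norm _) (normr_dot_le x y); lra.
Qed.

Lemma normr_coord_le x i : `|x ord0 i| <= enorm x.
Proof.
rewrite -(ler_pXn2r (n := 2)) ?nnegrE ?enorm_ge0// real_normK ?num_real//.
rewrite sqr_enorm /dot (bigD1 i)//= -expr2 lerDl sumr_ge0// => j _.
by rewrite -expr2 sqr_ge0.
Qed.

Lemma enorm_le_sum x : enorm x <= \sum_i `|x ord0 i|.
Proof.
rewrite -(ler_pXn2r (n := 2)) ?nnegrE ?enorm_ge0 ?sumr_ge0//.
rewrite sqr_enorm expr2 mulr_suml; apply: ler_sum => i _.
apply: (le_trans (ler_norm _)); rewrite normrM ler_wpM2l//.
by rewrite (bigD1 i)//= lerDl sumr_ge0.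
Qed.

Lemma enorm_le_coord x (c : R) : (forall i, `|x ord0 i| <= c) ->
  enorm x <= n%:R * c.
Proof.
move=> xc; apply: (le_trans (enorm_le_sum x)).
apply: (le_trans (ler_sum _ (fun i _ => xc i))).
by rewrite sumr_const card_ord mulr_natl.
Qed.

Lemma enorm_le_ediam (A : set 'rV[R]_n) x y : A x -> A y ->
  ((enorm (x - y))%:E <= ediam A)%E.
Proof. by move=> Ax Ay; apply: ereal_sup_ubound; exists (x, y). Qed.

End euclidean_facts.

Section hausdorff_facts.
Local Open Scope ereal_scope.
Context {R : realType} {n : nat}.
Implicit Types (X Y Z A B : set 'rV[R]_n).

Lemma hausdorff_ge0 m A : 0 <= hausdorff m A.
Proof. by have := surface_outer_ge0 m setT A; rewrite /surface_outer setIT. Qed.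

Lemma le_hausdorff m : {homo @hausdorff R n m : A B / A `<=` B >-> A <= B}.
Proof.
move=> A B; have := @le_surface_outer _ _ m setT A B.
by rewrite /surface_outer !setIT.
Qed.

Lemma le_hausdorff_gauge m (d1 d2 : R) A : (d1 <= d2)%R ->
  hausdorff_gauge m d2 A <= hausdorff_gauge m d1 A.
Proof.
move=> d12; rewrite /hausdorff_gauge; case: eqP => // _.
case: ifPn => [_|/negP d2A]; case: ifPn => //; first by rewrite leey.
by move=> /le_trans H; exfalso; apply/d2A/H; rewrite lee_fin.
Qed.

Lemma le_cover_gauge m (d1 d2 : R) A : (d1 <= d2)%R ->
  cover_measure (hausdorff_gauge m d2) A <= cover_measure (hausdorff_gauge m d1) A.
Proof.
move=> d12; apply: le_ereal_inf_tmp => _ [F AF <-].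
apply: (@le_trans _ _ (\sum_(k <oo) hausdorff_gauge m d2 (F k))).
  by apply: ereal_inf_lbound; exists F.
apply: lee_nneseries => k _; first by move=> _; exact: hausdorff_gauge_ge0.
exact: le_hausdorff_gauge.
Qed.

(** A covering set of diameter at most [d] cannot meet both [X] and [Y], whose [i]-th coordinates
    differ by more than [d]; a set of larger diameter already costs [+oo]. So a cover of the union
    splits into a cover of [X] and one of [Y] at no extra cost. *)
Lemma cover_gauge_separated m (d s t : R) (i : 'I_n) X Y : (d < t - s)%R ->
  X `<=` [set x | x ord0 i <= s]%R -> Y `<=` [set x | t <= x ord0 i]%R ->
  cover_measure (hausdorff_gauge m d) X + cover_measure (hausdorff_gauge m d) Y
  <= cover_measure (hausdorff_gauge m d) (X `|` Y).
Proof.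
move=> dst Xs Yt; apply: le_ereal_inf_tmp => _ [F XYF <-].
pose meet Z k := if F k `&` Z == set0 then set0 else F k.
have cov Z : Z `<=` X `|` Y ->
    cover_measure (hausdorff_gauge m d) Z <=
    \sum_(k <oo) hausdorff_gauge m d (meet Z k).
  move=> ZXY; apply: ereal_inf_lbound; exists (meet Z) => // x Zx.
  have [k _ Fkx] := XYF _ (ZXY _ Zx); exists k => //.
  by rewrite /meet; case: eqP => // /seteqP[/(_ x)+ _]; apply.
apply: (le_trans (leeD (cov X _) (cov Y _))); [exact: subsetUl|exact: subsetUr|].
rewrite -nneseriesD; [|by move=> *; exact: hausdorff_gauge_ge0..].
apply: lee_nneseries => k _.
  by move=> _; apply: adde_ge0; exact: hausdorff_gauge_ge0.
rewrite /meet; case: eqP => [_|/eqP/set0P[x [Fx Xx]]].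
  rewrite hausdorff_gauge0 add0e; case: eqP => // _.
  by rewrite hausdorff_gauge0 hausdorff_gauge_ge0.
case: eqP => [_|/eqP/set0P[y [Fy Yy]]]; first by rewrite hausdorff_gauge0 adde0.
rewrite [leRHS]/hausdorff_gauge; case: eqP => [F0|_]; first by rewrite F0 in Fx.
case: ifPn; last by rewrite leey.
move=> Fd; exfalso.
have := le_trans (enorm_le_ediam Fy Fx) Fd; rewrite lee_fin.
have := le_trans (ler_norm _) (normr_coord_le (y - x)%R i); rewrite !mxE.
have := Xs _ Xx; have := Yt _ Yy; rewrite /=; lra.
Qed.

Lemma hausdorff_separated m (s t : R) (i : 'I_n) X Y : (s < t)%R ->
  X `<=` [set x | x ord0 i <= s]%R -> Y `<=` [set x | t <= x ord0 i]%R ->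
  hausdorff m X + hausdorff m Y <= hausdorff m (X `|` Y).
Proof.
move=> st Xs Yt.
(* The two meshes are independent, so that the suprema defining the two measures can be taken one
   after the other; [d] refines both and stays below the gap. *)
have key (d1 d2 : R) : (0 < d1)%R -> (0 < d2)%R ->
    cover_measure (hausdorff_gauge m d1) X +
    cover_measure (hausdorff_gauge m d2) Y <= hausdorff m (X `|` Y).
  move=> d10 d20; pose d := Num.min (Num.min d1 d2) ((t - s) / 2)%R.
  have dst : (d < t - s)%R.
    by rewrite /d gt_min; apply/orP; right; lra.
  have d0 : (0 < d)%R by rewrite /d !lt_min d10 d20/=; lra.
  apply: (@le_trans _ _ (cover_measure (hausdorff_gauge m d) X +
    cover_measure (hausdorff_gauge m d) Y)).
    by apply: leeD; apply: le_cover_gauge; rewrite /d !ge_min lexx ?orbT.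
  apply: (le_trans (cover_gauge_separated m dst Xs Yt)).
  by apply: ereal_sup_ubound; exists d.
have [->|XYoo] := eqVneq (hausdorff m (X `|` Y)) +oo; first by rewrite leey.
(* Moving terms across the inequality needs finite values, available once the union has finite
   measure. *)
have fin (d : R) Z : (0 < d)%R -> Z `<=` X `|` Y ->
    cover_measure (hausdorff_gauge m d) Z \is a fin_num.
  move=> d0 ZXY; rewrite ge0_fin_numE; last first.
    exact: (cover_measure_ge0 (hausdorff_gauge_ge0 m d)).
  apply: (@le_lt_trans _ _ (hausdorff m (X `|` Y))); last by rewrite ltey.
  apply: (@le_trans _ _ (cover_measure (hausdorff_gauge m d) (X `|` Y))).
    exact: le_cover_measure.
  by apply: ereal_sup_ubound; exists d.
have H1 (d2 : R) : (0 < d2)%R ->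
    hausdorff m X + cover_measure (hausdorff_gauge m d2) Y <= hausdorff m (X `|` Y).
  move=> d20; rewrite -leeBrDr; last exact: fin.
  apply: ge_ereal_sup => _ [d1 /= d10 <-].
  by rewrite leeBrDr; [exact: key|exact: fin].
have Xfin : hausdorff m X \is a fin_num.
  rewrite ge0_fin_numE; last exact: hausdorff_ge0.
  apply: (@le_lt_trans _ _ (hausdorff m (X `|` Y))); last by rewrite ltey.
  exact/le_hausdorff/subsetUl.
rewrite addeC -leeBrDr//; apply: ge_ereal_sup => _ [d2 /= d20 <-].
by rewrite leeBrDr// addeC; exact: H1.
Qed.

End hausdorff_facts.

Section surface_measurability.
Context {R : realType} {n : nat}.
Implicit Types (B : set 'rV[R]_n).

Lemma surface_caratheodory m B (i : 'I_n) (a : R) :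
  (surface_outer m B).-caratheodory [set x : 'rV[R]_n | x ord0 i <= a].
Proof.
apply: (caratheodory_sublevel (h := fun x : 'rV[R]_n => x ord0 i)
  (mu := surface_outer m B)) => s t X Y st Xs Yt.
have := hausdorff_separated m (i := i) (X := X `&` B) (Y := Y `&` B) st.
rewrite -setIUl; apply; first by move=> x [/Xs].
by move=> x [/Yt].
Qed.

(** The outer measure only sees traces on [B], and the part of [X] outside [B] has empty trace. *)
Lemma measurable_surface_set B :
  measurable (B : set (caratheodory_type (surface_outer n.-1 B))).
Proof.
move=> X; change (hausdorff n.-1 (X `&` B) =
  hausdorff n.-1 (X `&` B `&` B) + hausdorff n.-1 (X `&` ~` B `&` B))%E.
have := surface_outer0 n.-1 B; rewrite /surface_outer set0I => h0.
by rewrite -!setIA setIid setICl setI0 h0 adde0.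
Qed.

(** Plane waves are continuous functions of these coordinates, so this settles their measurability
    for the Caratheodory sigma-algebra. *)
Lemma measurable_coord B (i : 'I_n) : measurable_fun setT
  (fun x : caratheodory_type (surface_outer n.-1 B) => x ord0 i).
Proof.
apply: (measurability _ (RGenOInfty.measurableE R)) => _ [_ [a ->] <-]; rewrite setTI.
rewrite (_ : _ @^-1` _ = ~` [set x : 'rV[R]_n | x ord0 i <= a]).
  by apply: measurableC; exact: surface_caratheodory.
by apply/seteqP; split => x; rewrite /= in_itv/= andbT ltNge => /negP.
Qed.

(** The complement of [B] is null, so the total mass in the abstract estimate is the area of [B]. *)
Lemma surfaceT B : surface B setT = surface B B.
Proof.
by change (surface_outer n.-1 B setT = surface_outer n.-1 B B);
  rewrite /surface_outer setTI setIid.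
Qed.

End surface_measurability.

(** * Finiteness of the Hausdorff measure of Lipschitz graphs *)

Section hausdorff_finite.
Local Open Scope ereal_scope.
Context {R : realType}.

Lemma cover_measure_fin (T : pointedType) (c : set T -> \bar R) (I : finType)
    (G : I -> set T) (A : set T) (b : R) :
  c set0 = 0 -> (forall X, 0 <= c X) -> A `<=` \bigcup_i G i ->
  (forall i, c (G i) <= b%:E) -> cover_measure c A <= (#|I|%:R * b)%:E.
Proof.
move=> c0 cge0 AG cG.
(* The finite cover is padded with [set0], of gauge 0, to a sequence. *)
pose F k := if insub k is Some i then G (enum_val (i : 'I_#|I|)) else set0.
apply: (@le_trans _ _ (\sum_(k <oo) c (F k))).
  apply: ereal_inf_lbound; exists F => // x /AG[i _ Gix].
  by exists (enum_rank i) => //; rewrite /F valK enum_rankK.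
rewrite (nneseries_split _ #|I|)// add0n [X in _ + X]eseries0 ?adde0; last first.
  by move=> k Ik _; rewrite /F insubF ?c0// ltnNge Ik.
rewrite (@le_trans _ _ (\sum_(0 <= k < #|I|) b%:E))//.
  rewrite !big_mkord; apply: lee_sum => i _; rewrite /F insubT//.
by rewrite sumEFin big_const_nat subn0 iter_addr_0 mulr_natl.
Qed.

Context {n : nat}.
Implicit Types (A : set 'rV[R]_n).

Lemma hausdorff_gauge_le m (d D : R) A : (0 <= D <= d)%R ->
  (forall x y, A x -> A y -> enorm (x - y) <= D)%R ->
  hausdorff_gauge m d A <= (unit_ball_volume m * (D / 2) ^+ m)%:E.
Proof.
move=> /andP[D0 Dd] AD; rewrite /hausdorff_gauge; case: eqP => [_|/eqP/set0P[x Ax]].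
  by rewrite lee_fin mulr_ge0 ?unit_ball_volume_ge0// exprn_ge0// divr_ge0.
have eD : ediam A <= D%:E.
  by apply: ge_ereal_sup => _ [[y z] /= [Ay Az] <-]; rewrite lee_fin AD.
rewrite (le_trans eD) ?lee_fin//.
have e0 : 0 <= ediam A.
  by apply: le_trans (enorm_le_ediam Ax Ax); rewrite lee_fin enorm_ge0.
have efin : ediam A \is a fin_num by rewrite ge0_fin_numE// (le_lt_trans eD) ?ltry.
rewrite ler_wpM2l ?unit_ball_volume_ge0// lerXn2r ?nnegrE ?divr_ge0 ?fine_ge0//.
by rewrite ler_pM2r// -lee_fin fineK.
Qed.

(* Split the parameter cube [-M, M]^m into N^m cells of side 2M/N. *)
Lemma hausdorff_lt_pinfty m A (q : 'rV[R]_n -> 'I_m -> R) (M L : R) :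
  (0 < M)%R -> (0 <= L)%R -> (forall x j, A x -> `|q x j| < M)%R ->
  (forall x y e, A x -> A y -> 0 <= e -> (forall j, `|q x j - q y j| <= e) ->
     enorm (x - y) <= L * e)%R ->
  hausdorff m A < +oo.
Proof.
move=> M0 L0 qM qL.
apply: (@le_lt_trans _ _ (unit_ball_volume m * (L * M) ^+ m)%:E); last by rewrite ltry.
apply: ge_ereal_sup => _ [d /= d0 <-].
(* Chosen so that a cell of side [w = 2M / N] pulls back to a set of diameter at most [L * w <= d],
   hence of finite gauge. *)
pose N := (Num.truncn (L * (2 * M) / d)).+1.
have N0 : (0 < N%:R :> R)%R by rewrite ltr0n.
pose w : R := (2 * M / N%:R)%R.
have w0 : (0 < w)%R by rewrite divr_gt0// mulr_gt0.
have Lwd : (0 <= L * w <= d)%R.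
  rewrite mulr_ge0 ?(ltW w0)//= /w mulrA ler_pdivrMr// [leRHS]mulrC -ler_pdivrMr//.
  by rewrite ltW// /N truncnS_gt.
have pos x j : A x -> (0 <= (q x j + M) / w)%R.
  by move=> /(qM _ j); rewrite ltr_norml => /andP[q1 _]; rewrite divr_ge0 ?ltW//; lra.
have tr x j : A x -> (Num.truncn ((q x j + M) / w) < N)%N.
  move=> Ax; rewrite truncn_lt_nat ?pos// ltr_pdivrMr// /w mulrC divfK ?gt_eqF//.
  by have := qM _ j Ax; rewrite ltr_norml => /andP[]; lra.
pose cell (f : {ffun 'I_m -> 'I_N}) :=
  A `&` [set x | forall j, Num.truncn ((q x j + M) / w) = f j].
(* Since [N * w = 2 * M], the total over [N ^ m] cells is the same for every mesh [d]. *)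
rewrite (_ : (_ * _)%R =
  #|{ffun 'I_m -> 'I_N}|%:R * (unit_ball_volume m * (L * w / 2) ^+ m))%R; last first.
  rewrite card_ffun !card_ord natrX mulrCA -exprMn; congr (_ * _ ^+ _)%R.
  by rewrite /w; field; rewrite gt_eqF.
apply: (cover_measure_fin (G := cell)).
- exact: hausdorff_gauge0.
- exact: hausdorff_gauge_ge0.
- move=> x Ax; exists [ffun j => Ordinal (tr x j Ax)] => //; split => //= j.
  by rewrite ffunE.
move=> f; apply: hausdorff_gauge_le => // x y [Ax /= xf] [Ay /= yf].
apply: qL => //; first exact: ltW.
move=> j.
have fl z : A z -> Num.truncn ((q z j + M) / w) = f j ->
    ((f j)%:R * w <= q z j + M < (f j).+1%:R * w)%R.
  move=> Az <-; rewrite -ler_pdivlMr// -ltr_pdivrMr//.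
  by rewrite truncn_itv// pos.
have /andP[] := fl _ Ax (xf j); have /andP[] := fl _ Ay (yf j).
rewrite -addn1 natrD mulrDl mul1r ler_norml => *; apply/andP; split; lra.
Qed.

End hausdorff_finite.

Section surface_finite.
Context {R : realType} {p : nat}.
Local Notation n := p.+1.
Implicit Types (A : set 'rV[R]_n) (x y e : 'rV[R]_n).

Lemma hausdorffU_lty m A B : (hausdorff m A < +oo)%E -> (hausdorff m B < +oo)%E ->
  (hausdorff m (A `|` B : set 'rV[R]_n) < +oo)%E.
Proof.
move=> Aoo Boo; have := outer_measureU2 (surface_outer m setT) A B.
rewrite -[X in (X <= _)%E]/(hausdorff m ((A `|` B) `&` setT)).
rewrite -[X in (_ <= X + _)%E]/(hausdorff m (A `&` setT)).
rewrite -[X in (_ <= _ + X)%E]/(hausdorff m (B `&` setT)) !setIT => /le_lt_trans; apply.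
exact: lte_add_pinfty.
Qed.

Lemma hausdorff_cover_lty m (I : eqType) (s : seq I) (G : I -> set 'rV[R]_n) A :
  A `<=` [set x | exists2 i, i \in s & G i x] ->
  (forall i, i \in s -> hausdorff m (G i) < +oo)%E -> (hausdorff m A < +oo)%E.
Proof.
elim: s A => [|i s IH] A AG Goo.
  have -> : A = set0 by apply/seteqP; split => // x /AG[].
  by have := surface_outer0 m (@set0 'rV[R]_n); rewrite /surface_outer setI0 => ->.
apply: (@le_lt_trans _ _ (hausdorff m (G i `|` [set x | exists2 i, i \in s & G i x]))).
  apply: le_hausdorff => x /AG[j]; rewrite inE => /predU1P[->|js] Gx; first by left.
  by right; exists j.
apply: hausdorffU_lty; first by apply: Goo; exact: mem_head.
by apply: IH => // j js; apply: Goo; rewrite inE js orbT.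
Qed.

Lemma forall_lift (P : 'I_n -> Prop) i :
  P i -> (forall j, P (lift i j)) -> forall k, P k.
Proof. by move=> Pi Pl k; case: (unliftP i k) => [j ->|->]. Qed.

(** Otherwise the sum of the absolute coordinates, which dominates [enorm x], would be below 1. *)
Lemma enorm1_coord x : enorm x = 1 -> exists i, n%:R^-1 <= `|x ord0 i|.
Proof.
move=> x1; apply: contrapT => /forallNP H.
have : enorm x < 1.
  apply: (le_lt_trans (enorm_le_sum x)).
  rewrite -[ltRHS](@mulfV _ (n%:R : R)) ?pnatr_eq0// mulr_natl.
  rewrite -[X in _ *+ X]card_ord -sumr_const; apply: ltr_sum => //.
    by apply/hasP; exists ord0 => //; rewrite mem_index_enum.
  by move=> i _; rewrite ltNge; apply/negP; exact: H.
by rewrite x1 ltxx.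
Qed.

(* On {s x_i >= 1/n} the i-th coordinate of a unit vector is a Lipschitz
   function of the others. *)
Lemma hausdorff_sphere_lty : (hausdorff p (@sphere R n) < +oo)%E.
Proof.
pose G (c : 'I_n * bool) : set 'rV[R]_n :=
  @sphere R n `&` [set x | n%:R^-1 <= (-1) ^+ c.2 * x ord0 c.1].
apply: (@hausdorff_cover_lty _ _ (enum {: 'I_n * bool}) G).
  move=> x x1; have [i ix] := enorm1_coord x1.
  exists (i, x ord0 i < 0); rewrite ?mem_enum//; split => //=.
  by rewrite -normrEsign.
move=> [i s] _; pose q x (j : 'I_p) : R := x ord0 (lift i j).
(* Any [M > 1] bounds the coordinates of unit vectors strictly. In [L], a factor [n ^ 2] recovers
   the omitted coordinate and one more [n] passes from coordinates to [enorm]. *)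
apply: (hausdorff_lt_pinfty (q := q) (M := 2) (L := n%:R ^+ 3)) => //.
- move=> x j [x1 _]; apply: (le_lt_trans (normr_coord_le _ _)).
  by rewrite x1; lra.
move=> x y e [x1 /= xi] [y1 /= yi] e0 qe.
have n1 : 1 <= n%:R :> R by rewrite ler1n.
have c1 z k : sphere z -> `|z ord0 k| <= 1.
  by move=> <-; exact: normr_coord_le.
have xyi : `|x ord0 i - y ord0 i| <= n%:R ^+ 2 * e.
  (* As both norms are 1, [x_i^2 - y_i^2] is the sum of [y_j^2 - x_j^2] over the other
     coordinates. *)
  have : `|(x ord0 i - y ord0 i) * (x ord0 i + y ord0 i)| <= p%:R * (e * 2).
    have : dot x x = dot y y by rewrite -!sqr_enorm (x1 : enorm x = 1) y1.
    rewrite /dot (bigD1_ord i)//= [in RHS](bigD1_ord i)//= => E.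
    have -> : (x ord0 i - y ord0 i) * (x ord0 i + y ord0 i) = \sum_(j < p)
       (y ord0 (lift i j) - x ord0 (lift i j)) *
       (y ord0 (lift i j) + x ord0 (lift i j)).
      rewrite (eq_bigr (fun j => y ord0 (lift i j) * y ord0 (lift i j) -
        x ord0 (lift i j) * x ord0 (lift i j))); last by move=> j _; ring.
      by rewrite sumrB; lra.
    apply: (le_trans (ler_norm_sum _ _ _)).
    rewrite -[in leRHS](card_ord p) mulr_natl -sumr_const; apply: ler_sum => j _.
    rewrite normrM; apply: ler_pM => //; first by rewrite distrC; exact: qe.
    by rewrite (le_trans (ler_normD _ _))// -[2]/(1 + 1) lerD// c1.
  rewrite normrM => H.
  (* Both [i]-th coordinates have the sign encoded by [s] and size at least [1/n], so they do not
     cancel. *)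
  have xy2 : 2 * n%:R^-1 <= `|x ord0 i + y ord0 i|.
    rewrite -(normrMsign s) mulrDr (le_trans _ (ler_norm _))//.
    by rewrite mulrDl mul1r lerD.
  have n0 : 0 < n%:R :> R by rewrite ltr0n.
  have pn : p%:R <= n%:R :> R by rewrite ler_nat.
  have : `|x ord0 i - y ord0 i| * (2 * n%:R^-1) <= p%:R * (e * 2).
    by apply: le_trans H; rewrite ler_wpM2l.
  rewrite [leLHS]mulrA ler_pdivrMr// => {}H.
  have : p%:R * e * n%:R <= n%:R ^+ 2 * e.
    by rewrite expr2 mulrAC ler_wpM2r// ler_wpM2r.
  lra.
have ne1 : e <= n%:R ^+ 2 * e by rewrite ler_peMl// exprn_ege1.
rewrite exprS -mulrA; apply: enorm_le_coord => k; rewrite !mxE.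
move: k; apply: (forall_lift (i := i)) => // j.
exact: le_trans (qe j) _.
Qed.

End surface_finite.

Section boundary_finite.
Context {R : realType} {p : nat}.
Local Notation n := p.+1.
Implicit Types (Omega : set 'rV[R]_n) (x y e : 'rV[R]_n).

Lemma mx_ball_enorm x y (r : R) : ball x r y -> enorm (y - x) <= n%:R * r.
Proof.
move=> [_ xy]; apply: enorm_le_coord => i; rewrite !mxE distrC ltW//.
exact: xy.
Qed.

Lemma bounded_bdry Omega : bounded_set Omega -> bounded_set (bdry Omega).
Proof.
move=> [M [Mreal OM]]; exists (M + 1); split; first by rewrite num_real.
move=> N MN x [clx _].
have [y [Oy xy]] := clx _ (nbhsx_ballx x 1 ltr01).
(* This bound lies strictly between [M] and [N - 1], leaving room for a point of [Omega] within
   distance 1. *)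
have M1 : M < (M + N - 1) / 2 by lra.
have /= yM := OM _ M1 y Oy.
move: xy; rewrite mx_norm_ball /ball_/= => xy.
rewrite -(subrK y x) (le_trans (ler_normD _ _))//.
have := ltW xy; move: yM; lra.
Qed.

Lemma compact_bdry Omega : bounded_set Omega -> compact (bdry Omega).
Proof.
move=> bO; apply: bounded_closed_compact; first exact: bounded_bdry.
rewrite /bdry setDE; apply: closedI; first exact: closed_closure.
by apply: open_closedC; exact: open_interior.
Qed.

(* A boundary point lies on the graph: above it is inside, strictly below it is
   outside with a neighbourhood. *)
Lemma bdry_on_graph Omega (zeta : 'rV[R]_n -> R) (L r : R) e q x :
  open Omega -> enorm e = 1 ->
  (forall x y, `|zeta x - zeta y| <= L * enorm (x - y)) ->
  (forall x, enorm (x - q) < r -> let w := x - q in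
     (Omega x <-> zeta (w - dot w e *: e) < dot w e)) ->
  bdry Omega x -> enorm (x - q) < r ->
  zeta (x - q - dot (x - q) e *: e) = dot (x - q) e.
Proof.
move=> oO e1 zL Oz [clx nx] xr.
have NOx : ~ Omega x by move=> Ox; apply: nx; rewrite (interior_id _).1.
apply/eqP; rewrite eq_le; apply/andP; split; last first.
  by rewrite leNgt; apply/negP => /(Oz _ xr).
rewrite leNgt; apply/negP => gap.
set h := zeta _ in gap; set t := dot _ _ in gap.
(* A displacement [v] changes the height by at most [|v|] and [zeta] by at most [2 |L| |v|], so a
   gap [h - t] survives any move shorter than [(h - t) / K]. *)
pose K := 1 + 2 * `|L|.
have K0 : 0 < K by rewrite /K ltr_pwDl.
pose s := Num.min ((h - t) / K) (r - enorm (x - q)).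
have s0 : 0 < s by rewrite lt_min divr_gt0 ?subr_gt0.
have n0 : 0 < n%:R :> R by rewrite ltr0n.
have sn : 0 < s / n%:R / 2 by rewrite !divr_gt0.
have [y [Oy /mx_ball_enorm]] := clx _ (nbhsx_ballx x _ sn).
rewrite mulrA (mulrC n%:R) divfK ?gt_eqF// => yx.
have {}yx : enorm (y - x) < s by lra.
have yr : enorm (y - q) < r.
  rewrite -(subrK x y) -addrA (le_lt_trans (enormD _ _))//.
  by rewrite -ltrBrDr (lt_le_trans yx)// ge_min lexx orbT.
have /(Oz _ yr) := Oy.
set v := y - x in yx *; set w := x - q.
have -> : y - q = v + w by rewrite /v /w addrA subrK.
have tv : `|dot v e| <= enorm v by rewrite -[leRHS]mulr1 -e1 normr_dot_le.
have := zL (v + w - dot (v + w) e *: e) (w - dot w e *: e).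
rewrite (_ : _ - _ - (_ - _) = v - dot v e *: e); last first.
  by rewrite dotDl scalerDl; apply/rowP => i; rewrite !mxE; ring.
have ev : enorm (v - dot v e *: e) <= 2 * enorm v.
  rewrite (le_trans (enormD _ _))// enormN enormZ e1; lra.
have zL' : L * enorm (v - dot v e *: e) <= `|L| * (2 * enorm v).
  apply: (le_trans (ler_norm _)).
  by rewrite normrM (ger0_norm (enorm_ge0 _)) ler_wpM2l.
move=> /le_trans/(_ zL'); rewrite ler_norml => /andP[zl _] zv.
have sK : s * K <= h - t by rewrite -ler_pdivlMr// ge_min lexx.
have vK : enorm v * K <= s * K by rewrite ler_pM2r// ltW.
have := le_trans (ler_norm _) tv; move: zv zl; rewrite dotDl -/h -/t.
have := le_trans vK sK; rewrite /K; lra.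
Qed.

(** Near [q] the boundary is a Lipschitz graph over the hyperplane orthogonal to [e]. The chart
    keeps [n - 1] coordinates of the horizontal component, dropping an index [i] with
    [|e_i| >= 1/n]: orthogonality to [e] recovers that one. *)
Lemma hausdorff_bdry_local Omega q : open Omega -> lipschitz_boundary Omega ->
  bdry Omega q -> exists2 r : R, 0 < r &
  (hausdorff p (bdry Omega `&` ball q r) < +oo)%E.
Proof.
move=> oO lO /lO[e [zeta [L [r [e1 r0 zL Oz]]]]].
have n0 : 0 < n%:R :> R by rewrite ltr0n.
exists (r / n%:R / 2); first by rewrite !divr_gt0.
set A := _ `&` _.
have Ar x : A x -> enorm (x - q) < r.
  move=> [_ /mx_ball_enorm]; rewrite mulrA (mulrC n%:R) divfK ?gt_eqF//; lra.
pose h x := x - q - dot (x - q) e *: e.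
have Ah x : A x -> zeta (h x) = dot (x - q) e.
  by move=> Ax; apply: (bdry_on_graph oO e1 zL Oz) (Ar _ Ax); case: Ax.
have [i ei] := enorm1_coord e1.
pose Q x (j : 'I_p) : R := h x ord0 (lift i j).
(* [2 * r] bounds the horizontal part of a vector shorter than [r]; [n ^ 3] controls the horizontal
   difference as on the sphere, and [1 + |L|] accounts for the height. *)
apply: (hausdorff_lt_pinfty (q := Q) (M := 2 * r)
  (L := (1 + `|L|) * n%:R ^+ 3)).
- by rewrite mulr_gt0.
- by rewrite mulr_ge0// ?exprn_ge0 ?addr_ge0.
- move=> x j Ax; apply: (le_lt_trans (normr_coord_le _ _)).
  have tv : `|dot (x - q) e| <= enorm (x - q) by rewrite -[leRHS]mulr1 -e1 normr_dot_le.
  rewrite (le_lt_trans (enormD _ _))// enormN enormZ e1.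
  have := Ar _ Ax; lra.
move=> x y eps Ax Ay eps0 Qe.
pose g := h x - h y.
have ge0 : dot g e = 0.
  have ee : dot e e = 1 by rewrite -sqr_enorm e1 expr1n.
  by rewrite /g /h !(dotBl, dotZl) ee; ring.
have e_le k : `|e ord0 k| <= 1 by rewrite -e1 normr_coord_le.
have gj j : `|g ord0 (lift i j)| <= eps.
  by rewrite /g !mxE; have := Qe j; rewrite /Q !mxE.
have n1 : 1 <= n%:R :> R by rewrite ler1n.
have gi : `|g ord0 i| <= n%:R ^+ 2 * eps.
  have : g ord0 i * e ord0 i = - \sum_(j < p) g ord0 (lift i j) * e ord0 (lift i j).
    by move: ge0; rewrite /dot (bigD1_ord i)//= => /eqP; rewrite addr_eq0 => /eqP.
  move=> /(congr1 Num.norm); rewrite normrN normrM => gE.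
  have : `|g ord0 i| * n%:R^-1 <= p%:R * eps.
    apply: (@le_trans _ _ (`|g ord0 i| * `|e ord0 i|)); first by rewrite ler_wpM2l.
    rewrite gE (le_trans (ler_norm_sum _ _ _))//.
    rewrite -[in leRHS](card_ord p) mulr_natl -sumr_const; apply: ler_sum => j _.
    by rewrite normrM -[leRHS]mulr1 ler_pM.
  rewrite ler_pdivrMr// => H; apply: (le_trans H).
  by rewrite expr2 mulrAC ler_wpM2r// ler_wpM2r// ler_nat.
have eps1 : eps <= n%:R ^+ 2 * eps by rewrite ler_peMl// exprn_ege1.
have gn : enorm g <= n%:R ^+ 3 * eps.
  rewrite exprS -mulrA; apply: enorm_le_coord => k.
  by move: k; apply: (forall_lift (i := i)) => // j; exact: le_trans (gj j) _.
have -> : x - y = g + (zeta (h x) - zeta (h y)) *: e.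
  by rewrite !Ah// /g /h; apply/rowP => k; rewrite !mxE; ring.
rewrite (le_trans (enormD _ _))// enormZ e1 mulr1.
have zg := le_trans (zL (h x) (h y)) (ler_wpM2r (enorm_ge0 _) (ler_norm L)).
rewrite (le_trans (lerD (lexx _) zg))// -/g -[X in X + _]mul1r -mulrDl -mulrA.
by rewrite ler_wpM2l// addr_ge0.
Qed.

(** Compactness of the boundary leaves finitely many local pieces; at points off the boundary the
    radius is a dummy 1. *)
Lemma hausdorff_bdry_lty Omega : bounded_lipschitz_domain Omega ->
  (hausdorff p (bdry Omega) < +oo)%E.
Proof.
move=> [_ oO _ bO lO].
have /choice[r Hr] : forall q : 'rV[R]_n, exists r : R, 0 < r /\
    (bdry Omega q -> hausdorff p (bdry Omega `&` ball q r) < +oo)%E.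
  move=> q; have [bq|nbq] := pselect (bdry Omega q).
    by have [r r0 Hr] := hausdorff_bdry_local oO lO bq; exists r.
  by exists 1.
have := compact_bdry bO; rewrite compact_cover.
move=> /(_ _ (bdry Omega) (fun q => (ball q (r q))^°)) [].
- by move=> q _; exact: open_interior.
- move=> q bq; exists q => //; apply: nbhsx_ballx; exact: (Hr q).1.
move=> F FD bF.
apply: (@hausdorff_cover_lty _ _ _ _ (enum_fset F)
  (fun q => bdry Omega `&` ball q (r q))).
  move=> x bx; have [q /= qF /interior_subset xq] := bF _ bx.
  by exists q.
move=> q qF; apply: (Hr q).2; have := FD q qF.
by rewrite in_setE.
Qed.

End boundary_finite.

(** * Lower bounds for the Hausdorff measure of the unit sphere *)

Section hausdorff_lower_bound.
Context {R : realType}.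

(** Covers are transported by [f]: a cover of [A] yields measurable sets covering [E] whose
    [mu]-mass is at most the gauge. Mesh 1 suffices, as [hausdorff] is a supremum over meshes. *)
Lemma hausdorff_ge_measure d (T : measurableType d) (mu : {measure set T -> \bar R})
    (n m : nat) (f : 'rV[R]_n -> T) (E : set T) (A : set 'rV[R]_n) :
  (forall (F : set 'rV[R]_n) (D : R), F !=set0 -> 0 <= D ->
    (forall x y, F x -> F y -> enorm (x - y) <= D) ->
    exists Q, [/\ measurable Q, f @` F `<=` Q &
      (mu Q <= (unit_ball_volume m * (D / 2) ^+ m)%:E)%E]) ->
  measurable E -> E `<=` f @` A -> (mu E <= hausdorff m A)%E.
Proof.
move=> Hf mE EA.
have Q_ex (F : set 'rV[R]_n) : exists Q, [/\ measurable Q, f @` F `<=` Q &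
    (mu Q <= hausdorff_gauge m 1 F)%E].
  rewrite /hausdorff_gauge; case: eqP => [->|/eqP F0].
    by exists set0; split => //; [rewrite image_set0|rewrite measure0].
  case: ifPn => Fd; last by exists setT; split => //; rewrite leey.
  have /set0P[x Fx] := F0.
  have e0 : (0 <= ediam F)%E.
    by apply: le_trans (enorm_le_ediam Fx Fx); rewrite lee_fin enorm_ge0.
  have efin : ediam F \is a fin_num by rewrite ge0_fin_numE// (le_lt_trans Fd) ?ltry.
  apply: Hf; [by exists x|by rewrite fine_ge0|].
  by move=> y z Fy Fz; rewrite -lee_fin fineK// enorm_le_ediam.
apply: (@le_trans _ _ (cover_measure (hausdorff_gauge m 1) A)); last first.
  by apply: ereal_sup_ubound; exists 1 => //=; exact: ltr01.
apply: le_ereal_inf_tmp => _ [F AF <-].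
have /choice[Q HQ] : forall k, exists Q, [/\ measurable Q, f @` F k `<=` Q &
  (mu Q <= hausdorff_gauge m 1 (F k))%E] by move=> k; exact: Q_ex.
apply: (@le_trans _ _ (\sum_(k <oo) mu (Q k))%E).
  apply: measure_sigma_subadditive => //; first by move=> k; have [] := HQ k.
  move=> y /EA[x /AF[k _ Fx] <-]; exists k => //.
  by have [_ + _] := HQ k; apply; exists x.
by apply: lee_nneseries => // k _; have [] := HQ k.
Qed.

Lemma itv_hull (P : set R) (D : R) : P !=set0 ->
  (forall x y, P x -> P y -> x - y <= D) ->
  exists a, P `<=` [set x | a <= x <= a + D].
Proof.
move=> P0 PD; have [x0 Px0] := P0; exists (inf P) => x Px /=.
have lbP y : P y -> lbound P (y - D).
  by move=> Py z Pz; have := PD _ _ Py Pz; lra.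
apply/andP; split; first by apply: ge_inf => //; exists (x0 - D); exact: lbP.
by rewrite -lerBlDr; apply: lb_le_inf => //; exact: lbP.
Qed.

Lemma coord_hull n (F : set 'rV[R]_n) (D : R) (i : 'I_n) : F !=set0 ->
  (forall x y, F x -> F y -> enorm (x - y) <= D) ->
  exists a, forall x, F x -> x ord0 i \in `[a, a + D].
Proof.
move=> [x0 Fx0] FD.
have [a aP] : exists a, [set x ord0 i | x in F] `<=` [set x | a <= x <= a + D].
  apply: itv_hull; first by exists (x0 ord0 i), x0.
  move=> _ _ [x Fx <-] [y Fy <-]; apply: le_trans (FD _ _ Fx Fy).
  by apply: le_trans (le_trans (ler_norm _) (normr_coord_le _ i)); rewrite !mxE.
by exists a => x Fx; rewrite in_itv/=; apply: aP; exists x.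
Qed.

Lemma lebesgue_itv_cc (a b : R) : a <= b ->
  lebesgue_measure `[a, b]%classic = (b - a)%:E.
Proof.
rewrite le_eqVlt lebesgue_measure_itv/= => /predU1P[->|ab].
  by rewrite ltxx subrr.
by rewrite lte_fin ab EFinB.
Qed.

(** The first coordinate maps the circle onto [[-1, 1]], and the one-dimensional gauge [2 * (D / 2)]
    is exactly the length of an interval of diameter [D]. *)
Lemma hausdorff_circle_ge1 : (1 <= hausdorff 1 (@sphere R 2))%E.
Proof.
apply: (@le_trans _ _ (lebesgue_measure `[-1, 1]%classic : \bar R)).
  by rewrite lebesgue_itv_cc ?lee_fin; lra.
apply: (hausdorff_ge_measure (mu := lebesgue_measure)
   (f := fun x : 'rV[R]_2 => x ord0 ord0)).
- move=> F D F0 D0 FD; have [a aF] := coord_hull ord0 F0 FD.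
  exists `[a, a + D]%classic; split => //.
    by move=> _ [x Fx <-]; exact: aF.
  rewrite -[X in (X <= _)%E]/(lebesgue_measure `[a, a + D]%classic).
  by rewrite lebesgue_itv_cc ?lerDl// lee_fin/= expr1; lra.
- exact: measurable_itv.
move=> u /=; rewrite in_itv/= => /andP[u1 u2].
have u0 : 0 <= 1 - u ^+ 2 by nra.
exists (\row_(j < 2) [:: u; Num.sqrt (1 - u ^+ 2)]`_j); last by rewrite mxE.
rewrite /sphere/= /enorm /dot !big_ord_recl big_ord0 !mxE/= -!expr2 sqr_sqrtr//.
by rewrite addr0 addrC subrK sqrtr1.
Qed.

(** The first two coordinates cover the square inscribed in the unit disc, of area 2. Lebesgue
    measure is scaled by [pi / 4] because a set of diameter [D] projects into a square of area
    [D^2], while its gauge is [pi * (D / 2)^2]; the resulting mass is [pi / 2]. *)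
Lemma hausdorff_sphere_ge1 : (1 <= hausdorff 2 (@sphere R 3))%E.
Proof.
pose leb := @lebesgue_measure R.
have pi4 : 0 <= pi / 4 :> R by rewrite divr_ge0// pi_ge0.
pose mu := mscale (NngNum pi4) (leb \x leb)%E.
pose s : R := Num.sqrt (1 / 2).
have s2 : s ^+ 2 = 1 / 2 by rewrite sqr_sqrtr//; lra.
have s0 : 0 <= s by exact: sqrtr_ge0.
apply: (@le_trans _ _ (mu (`[- s, s] `*` `[- s, s])%classic : \bar R)).
  rewrite /mu /mscale/= product_measure1E//=; [|exact: measurable_itv..].
  rewrite !lebesgue_itv_cc; [|lra..].
  rewrite -!EFinM lee_fin opprK.
  have -> : (s + s) * (s + s) = 2 by move: s2; rewrite expr2; lra.
  by have := pi_ge2 R; lra.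
apply: (hausdorff_ge_measure (mu := mu)
   (f := fun x : 'rV[R]_3 => (x ord0 ord0, x ord0 (lift ord0 ord0)))).
- move=> F D F0 D0 FD; have [a aF] := coord_hull ord0 F0 FD.
  have [b bF] := coord_hull (lift ord0 ord0) F0 FD.
  exists (`[a, a + D] `*` `[b, b + D])%classic; split.
  + by apply: measurableX; exact: measurable_itv.
  + by move=> _ [x Fx <-]; split; [exact: aF|exact: bF].
  rewrite -[X in (X <= _)%E]/((pi / 4)%:E *
    (leb \x leb) (`[a, (a + D)%R] `*` `[b, (b + D)%R])%classic)%E.
  rewrite product_measure1E//=; [|exact: measurable_itv..].
  rewrite !lebesgue_itv_cc ?lerDl//.
  by rewrite -!EFinM lee_fin expr2; lra.
- by apply: measurableX; exact: measurable_itv.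
move=> [u v] /= []; rewrite !in_itv/= => /andP[u1 u2] /andP[v1 v2].
have uv0 : 0 <= 1 - u ^+ 2 - v ^+ 2.
  have : u ^+ 2 <= s ^+ 2 by nra.
  have : v ^+ 2 <= s ^+ 2 by nra.
  lra.
exists (\row_(j < 3) [:: u; v; Num.sqrt (1 - u ^+ 2 - v ^+ 2)]`_j);
  last by rewrite !mxE.
rewrite /sphere/= /enorm /dot !big_ord_recl big_ord0 !mxE/= -!expr2 sqr_sqrtr//.
rewrite (_ : _ + _ = 1) ?sqrtr1//; ring.
Qed.

End hausdorff_lower_bound.

(** * Plane waves and their normal derivative *)

Lemma fin_num_surface (R : realType) (n : nat) (B : set 'rV[R]_n) :
  (hausdorff n.-1 B < +oo)%E -> fin_num_fun (surface B).
Proof.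
move=> Boo A mA; rewrite ge0_fin_numE//; apply: le_lt_trans Boo.
rewrite -[X in (X <= _)%E]/(hausdorff n.-1 (A `&` B)).
by apply: le_hausdorff => x [].
Qed.

Lemma measurable_comp_snd d1 d2 d3 (T1 : measurableType d1)
    (T2 : measurableType d2) (T3 : measurableType d3) (A : set T1) (B : set T2)
    (h : T2 -> T3) : measurable B -> measurable_fun B h ->
  measurable_fun (A `*` B) (fun p => h p.2).
Proof.
move=> mB mh; have msnd : measurable_fun (A `*` B) snd by exact: measurable_funTS.
by apply: (measurable_comp mB _ mh msnd) => _ [[a b] [_ Bb] <-].
Qed.

Section bounded_kernel.
Context d1 d2 (Y : measurableType d1) (S : measurableType d2) {R : realType}.
Variables (mu : {finite_measure set Y -> \bar R})
  (sigma : {finite_measure set S -> \bar R}) (B : set Y) (D : set S).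
Hypotheses (mB : measurable B) (mD : measurable D).

(** Bounded functions are square integrable for finite measures. The exceptional null set may depend
    on [x], which suits a unit normal defined only almost everywhere, and still every row is in
    [L2]. *)
Lemma L2_bounded_kernel (K : S -> Y -> R[i]) (c : R) :
  cmeasurable (D `*` B) (fun p => K p.1 p.2) ->
  (forall x, D x -> {ae mu, forall y, B y -> modulus (K x y) <= c}) ->
  L2 (sigma \x mu)%E (D `*` B) (fun p => K p.1 p.2) /\
  forall x, D x -> L2 mu B (K x).
Proof.
move=> mK Kc.
have mDB : measurable (D `*` B) by exact: measurableX.
set Z := zext (D `*` B) (fun p => K p.1 p.2).
have mZ : cmeasurable setT Z by exact: cmeasurable_zext.
have mZx x : cmeasurable setT (fun y => Z (x, y)).
  by apply: (cmeasurableT_comp mZ); exact: pair1_measurable.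
have Zx x : (\int[mu]_y (modulus (Z (x, y)) ^+ 2)%:E <= (c ^+ 2)%:E * mu setT)%E.
  rewrite -integral_cst//; apply: ae_ge0_le_integral => //.
  - by move=> y _; rewrite lee_fin sqr_ge0.
  - exact/measurable_EFinP/measurable_sqr_modulus.
  - by move=> y _; rewrite lee_fin sqr_ge0.
  have [Dx|Dx] := pselect (D x); last first.
    apply: aeW => y _; rewrite /Z zext_out; last by case.
    by rewrite sqr_modulus/= expr0n addr0 lee_fin sqr_ge0.
  have := Kc x Dx; apply: filterS => y Kxy _; rewrite lee_fin.
  have [By|By] := pselect (B y); last first.
    rewrite /Z zext_out; last by case.
    by rewrite sqr_modulus/= expr0n addr0 sqr_ge0.
  rewrite /Z zext_in//= lerXn2r ?nnegrE ?modulus_ge0 ?Kxy//.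
  exact: le_trans (modulus_ge0 _) (Kxy By).
have c2oo : ((c ^+ 2)%:E * mu setT < +oo)%E.
  by rewrite lte_mul_pinfty ?lee_fin ?sqr_ge0// -ge0_fin_numE// fin_num_measure.
split; last first.
  move=> x Dx; split; last first.
    rewrite integral_sqr_zext; apply: le_lt_trans c2oo; apply: le_trans (Zx x).
    rewrite le_eqVlt; apply/orP; left; apply/eqP; apply: eq_integral => y _.
    have [By|By] := pselect (B y); first by rewrite /Z !zext_in.
    by rewrite /Z !zext_out// => -[].
  have eqB y : y \in B -> K x y = Z (x, y).
    by rewrite in_setE => By; rewrite /Z zext_in.
  have [mR mI] := mZx x; split.
  - apply: (eq_measurable_fun (fun y => complex.Re (Z (x, y)))).
      by move=> y By; rewrite /= -eqB.
    exact: measurable_funTS.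
  - apply: (eq_measurable_fun (fun y => complex.Im (Z (x, y)))).
      by move=> y By; rewrite /= -eqB.
    exact: measurable_funTS.
split => //; rewrite integral_sqr_zext -/Z fubini_tonelli1//=; last 2 first.
- exact/measurable_EFinP/measurable_sqr_modulus.
- by move=> p; rewrite lee_fin sqr_ge0.
apply: (@le_lt_trans _ _ (\int[sigma]_x cst ((c ^+ 2)%:E * mu setT)%E x)%E).
  apply: ge0_le_integral => //.
  - by move=> x _; apply: integral_ge0 => y _; rewrite lee_fin sqr_ge0.
  - apply: measurable_fun_fubini_tonelli_F => /=.
      exact/measurable_EFinP/measurable_sqr_modulus.
    by move=> p; rewrite lee_fin sqr_ge0.
  - by move=> x _; exact: Zx.
rewrite integral_cst// lte_mul_pinfty ?mule_ge0 ?lee_fin ?sqr_ge0//.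
- by rewrite ge0_fin_numE// mule_ge0 ?lee_fin ?sqr_ge0.
- by rewrite -ge0_fin_numE// fin_num_measure.
Qed.

End bounded_kernel.

Section plane_waves.
Context {R : realType} {n : nat}.
Implicit Types (x y v z : 'rV[R]_n) (k : R).

Lemma modulus_expi (t : R) : modulus (expi t) = 1.
Proof. by rewrite /modulus/= cos2Dsin2 sqrtr1. Qed.

(** Along [y + h v] the phase is affine in [h], so the chain rule of one variable applies. *)
Lemma derive_comp_dot (F : R -> R) (k dF : R) x y v :
  is_derive (k * dot x y) (1 : R) F dF ->
  'D_v (fun y => F (k * dot x y)) y = dF * (k * dot x v).
Proof.
move=> Fd; transitivity ('D_1 (F \o (fun h : R => k * dot x y + h * (k * dot x v))) 0).
  rewrite /derive; set f := (X in X @ _); set g := (X in _ = lim (X @ _)).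
  suff -> : f = g by [].
  apply/funext => h; rewrite /f /g /= mul0r !addr0; congr (_ *: (F _ - _)).
  by rewrite dotC dotDl dotZl !(dotC _ x) /GRing.scale/=; ring.
have lin : is_derive (0 : R) (1 : R)
    (fun h : R => k * dot x y + h * (k * dot x v)) (k * dot x v).
  apply: is_derive_eq.
  by rewrite scaler0 !add0r mul1r /GRing.scale/= mulr1.
apply: derive_val.
apply: is_derive1_comp; first by rewrite mul0r addr0.
Qed.

Lemma dnu_Phi_infE (nu : 'rV[R]_n -> 'rV[R]_n) k x y :
  dnu_Phi_inf nu k x y = (0 +i* - (k * dot x (nu y))) * Phi_inf k x y.
Proof.
rewrite /dnu_Phi_inf /cderive /Phi_inf; case: (far_field_constant _) => a b /=.
(* [C] and [S] are the real and imaginary parts of [(a + i b) * expi (- t)], hence [C' = S] and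
   [S' = - C]. *)
pose C (t : R) := a * cos (- t) - b * sin (- t).
pose S (t : R) := a * sin (- t) + b * cos (- t).
have dC t : is_derive t (1 : R) C (S t).
  by apply: is_derive_eq; rewrite /C /S /GRing.scale/=; ring.
have dS t : is_derive t (1 : R) S (- C t).
  by apply: is_derive_eq; rewrite /C /S /GRing.scale/=; ring.
rewrite (derive_comp_dot (F := C)) (derive_comp_dot (F := S)).
apply/eqP; rewrite eq_complex /=; apply/andP; split; apply/eqP; rewrite /C /S; ring.
Qed.

Lemma modulus_Phi_inf k x y :
  modulus (Phi_inf k x y) = modulus (@far_field_constant R n k).
Proof. by rewrite /Phi_inf modulusM modulus_expi mulr1. Qed.

Lemma modulus_dnu_Phi_inf_le (nu : 'rV[R]_n -> 'rV[R]_n) k x y : 0 < k ->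
  enorm x = 1 -> enorm (nu y) = 1 ->
  modulus (dnu_Phi_inf nu k x y) <= k * modulus (@far_field_constant R n k).
Proof.
move=> k0 x1 nu1; rewrite dnu_Phi_infE modulusM modulus_Phi_inf.
rewrite ler_wpM2r ?modulus_ge0// /modulus/= expr0n add0r sqrrN sqrtr_sqr.
rewrite normrM gtr0_norm//; apply: ler_piMr; first exact: ltW.
by rewrite (le_trans (normr_dot_le _ _))// x1 nu1 mulr1.
Qed.

Lemma cmeasurable_expi d (T : measurableType d) (D : set T) (f : T -> R) :
  measurable_fun D f -> cmeasurable D (fun p => expi (f p)).
Proof.
move=> mf; split; apply: measurableT_comp mf => //;
  apply: continuous_measurable_fun; [exact: continuous_cos|exact: continuous_sin].
Qed.

Lemma cmeasurable_cst d (T : measurableType d) (D : set T) (c : R[i]) :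
  cmeasurable D (fun=> c).
Proof. by split; exact: measurable_cst. Qed.

Lemma measurable_dot d (T : measurableType d) (D : set T)
    (f g : T -> 'rV[R]_n) :
  (forall i, measurable_fun D (fun p => f p ord0 i)) ->
  (forall i, measurable_fun D (fun p => g p ord0 i)) ->
  measurable_fun D (fun p => dot (f p) (g p)).
Proof.
by move=> mf mg; apply: measurable_sum => i; exact: measurable_funM.
Qed.

Lemma measurable_phase d (T : measurableType d) (D : set T) k
    (f g : T -> 'rV[R]_n) :
  (forall i, measurable_fun D (fun p => f p ord0 i)) ->
  (forall i, measurable_fun D (fun p => g p ord0 i)) ->
  measurable_fun D (fun p => - (k * dot (f p) (g p))).
Proof.
move=> mf mg; under eq_fun do rewrite -mulNr.
by apply: measurable_funM; [exact: measurable_cst|exact: measurable_dot].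
Qed.

Lemma measurable_coord_comp d (T : measurableType d) (B : set 'rV[R]_n)
    (h : T -> caratheodory_type (surface_outer n.-1 B)) (i : 'I_n) :
  measurable_fun setT h -> measurable_fun setT (fun p => h p ord0 i).
Proof. by move=> mh; have := measurableT_comp (measurable_coord (B := B) i) mh. Qed.

Lemma cmeasurable_phi_z (B : set 'rV[R]_n) k z : cmeasurable
  (B : set (caratheodory_type (surface_outer n.-1 B))) (phi_z k z).
Proof.
apply: cmeasurable_expi; apply: measurable_phase => i.
  by apply: measurable_funTS; exact: measurable_coord.
exact: measurable_cst.
Qed.

Lemma cmeasurable_Phi_inf (A B : set 'rV[R]_n) k : cmeasurable
  (A `*` B : set (caratheodory_type (surface_outer n.-1 A) *
                  caratheodory_type (surface_outer n.-1 B)))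
  (fun p => Phi_inf k p.1 p.2).
Proof.
apply: cmeasurableM; first exact: cmeasurable_cst.
apply: cmeasurable_expi; apply: measurable_phase => i; apply: measurable_funTS.
  exact: measurable_coord_comp.
exact: measurable_coord_comp.
Qed.

Lemma cmeasurable_dnu_Phi_inf (A B : set 'rV[R]_n) (nu : 'rV[R]_n -> 'rV[R]_n) k :
  (forall i, measurable_fun
     (B : set (caratheodory_type (surface_outer n.-1 B)))
     (fun y : caratheodory_type (surface_outer n.-1 B) => nu y ord0 i)) ->
  cmeasurable
  (A `*` B : set (caratheodory_type (surface_outer n.-1 A) *
                  caratheodory_type (surface_outer n.-1 B)))
  (fun p => dnu_Phi_inf nu k p.1 p.2).
Proof.
move=> mnu; under eq_fun do rewrite dnu_Phi_infE.
apply: cmeasurableM; last exact: cmeasurable_Phi_inf.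
split; first exact: measurable_cst.
apply: measurable_phase => i.
  apply: measurable_funTS.
  exact: measurable_coord_comp.
exact: (@measurable_comp_snd _ _ _ (caratheodory_type (surface_outer n.-1 A))
  (caratheodory_type (surface_outer n.-1 B)) _ A B _
  (measurable_surface_set B) (mnu i)).
Qed.

End plane_waves.

(** * Application to the surface measures of the boundary and the sphere *)

Section finite_of_measure.
Context d (T : measurableType d) {R : realType}.
Variables (mu : {measure set T -> \bar R}) (muoo : fin_num_fun mu).

(* The finiteness proof is an argument so that the instances below, which need
   it, can be inferred from the term. *)
Definition finite_of_measure of fin_num_fun mu : set T -> \bar R := mu.

HB.instance Definition _ := isMeasure.Build _ _ _ (finite_of_measure muoo)
  (measure0 mu) (measure_ge0 mu) (@measure_semi_sigma_additive _ _ _ mu).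

HB.instance Definition _ := Measure_isFinite.Build _ _ _
  (finite_of_measure muoo) muoo.

End finite_of_measure.

(** Here the area enters to the first power, and one relative noise level [t] serves both data. *)
Lemma indicator_stability (R : realType) (p : nat)
  (Omega : set 'rV[R]_p.+1) (hOmega : bounded_lipschitz_domain Omega)
  (nu : 'rV[R]_p.+1 -> 'rV[R]_p.+1) (hnu : outward_unit_normal Omega nu)
  (k : R) (hk : 0 < k)
  (f g f' g' : 'rV[R]_p.+1 -> 'rV[R]_p.+1 -> R[i])
  (Lf : L2_prod (bdry Omega) sphere f) (Lg : L2_prod (bdry Omega) sphere g)
  (Lf' : L2_prod (bdry Omega) sphere f') (Lg' : L2_prod (bdry Omega) sphere g')
  (t : R) (t0 : 0 <= t)
  (hf : L2norm_prod (bdry Omega) sphere (fun y d => f y d - f' y d) <=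
     t * L2norm_prod (bdry Omega) sphere f)
  (hg : L2norm_prod (bdry Omega) sphere (fun y d => g y d - g' y d) <=
     t * L2norm_prod (bdry Omega) sphere g) (z : 'rV[R]_p.+1) :
  `|indicator Omega nu k f g z - indicator Omega nu k f' g' z| <=
  sphere_area (R := R) (n := p.+1)
    * (L2norm_prod sphere (bdry Omega) (dnu_Phi_inf nu k) ^+ 2 +
       L2norm_prod sphere (bdry Omega) (Phi_inf k) ^+ 2)
    * (L2norm_prod (bdry Omega) sphere f ^+ 2 +
       L2norm_prod (bdry Omega) sphere g ^+ 2)
    * (2 * t + t ^+ 2).
Proof.
pose mu : {finite_measure set _ -> \bar R} :=
  finite_of_measure (fin_num_surface (hausdorff_bdry_lty hOmega)).
pose sigma : {finite_measure set _ -> \bar R} :=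
  finite_of_measure (fin_num_surface (@hausdorff_sphere_lty R p)).
have [mnu aenu] := hnu.
have {}aenu : {ae mu, forall y, bdry Omega y ->
  outward_unit_normal_at Omega y (nu y)} := aenu.
have mB := measurable_surface_set (bdry Omega).
have mD := measurable_surface_set (@sphere R p.+1).
have Phi_le x (_ : sphere x) : {ae mu, forall y, bdry Omega y ->
    modulus (Phi_inf k x y) <= modulus (@far_field_constant R p.+1 k)}.
  by apply: aeW => y _; rewrite modulus_Phi_inf.
have dPhi_le x (x1 : sphere x) : {ae mu, forall y, bdry Omega y ->
    modulus (dnu_Phi_inf nu k x y) <= k * modulus (@far_field_constant R p.+1 k)}.
  apply: (@filterS _ _ (ae_filter_ringOfSetsType mu)) aenu => y nuy By.
  by have [nu1 _] := nuy By; exact: modulus_dnu_Phi_inf_le.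
have [LP LPx] := @L2_bounded_kernel _ _ _ _ _ mu sigma _ _ mB mD _ _
  (cmeasurable_Phi_inf (@sphere R p.+1) (bdry Omega) k) Phi_le.
have [LQ LQx] := @L2_bounded_kernel _ _ _ _ _ mu sigma _ _ mB mD _ _
  (cmeasurable_dnu_Phi_inf (@sphere R p.+1) k mnu) dPhi_le.
have phi1 (s : 'rV[R]_p.+1) : sphere s -> modulus (phi_z k z s) <= 1.
  by rewrite modulus_expi.
have := energy_stability mB mD LQ LP LQx LPx
  (cmeasurable_phi_z (@sphere R p.+1) k z) phi1
  t0 Lf Lg Lf' Lg' hf hg.
rewrite (surfaceT (@sphere R p.+1)).
exact.
Qed.

(** Finiteness matters: [fine] sends [+oo] to 0. *)
Lemma sphere_area_ge1 (R : realType) (p : nat) :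
  (1 <= hausdorff p (@sphere R p.+1))%E -> 1 <= sphere_area (R := R) (n := p.+1).
Proof.
move=> s1; rewrite /sphere_area.
rewrite -[X in fine X]/(hausdorff p (sphere `&` (@sphere R p.+1))) setIid.
rewrite -lee_fin fineK// ge0_fin_numE; last exact: hausdorff_ge0.
exact: hausdorff_sphere_lty.
Qed.

Theorem theorem5 (R : realType) (n : nat) (hn : n = 2%N \/ n = 3%N)
  (D Omega : set 'rV[R]_n)
  (hD : bounded_lipschitz_domain D) (hDc : connected (~` closure D))
  (hOmega : bounded_lipschitz_domain Omega) (hDOmega : D `<=` Omega)
  (eta : 'rV[R]_n -> R[i]) (heta : contrast D eta)
  (nu : 'rV[R]_n -> 'rV[R]_n) (hnu : outward_unit_normal Omega nu)
  (k : R) (hk : 0 < k)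
  (* scattered field in R^n, as a function of (x, d) *)
  (usc : 'rV[R]_n -> 'rV[R]_n -> R[i])
  (husc : forall d, sphere d -> scattered_field k eta d (usc ^~ d))
  (* its Dirichlet and Neumann traces, as functions of (y, d) *)
  (u dnu_u : 'rV[R]_n -> 'rV[R]_n -> R[i])
  (hu : forall d, sphere d -> is_trace Omega (usc ^~ d) (u ^~ d))
  (hdnu_u : forall d, sphere d ->
     is_normal_trace Omega nu (usc ^~ d) (dnu_u ^~ d))
  (hu2 : L2_prod (bdry Omega) sphere u)
  (hdnu_u2 : L2_prod (bdry Omega) sphere dnu_u)
  (delta1 delta2 : R) (hdelta1 : 0 < delta1) (hdelta2 : 0 < delta2)
  (u' dnu_u' : 'rV[R]_n -> 'rV[R]_n -> R[i])
  (hu' : L2_prod (bdry Omega) sphere u')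
  (hdnu_u' : L2_prod (bdry Omega) sphere dnu_u')
  (hnoise1 : L2norm_prod (bdry Omega) sphere (fun y d => u y d - u' y d) <=
     delta1 * L2norm_prod (bdry Omega) sphere u)
  (hnoise2 : L2norm_prod (bdry Omega) sphere
       (fun y d => dnu_u y d - dnu_u' y d) <=
     delta2 * L2norm_prod (bdry Omega) sphere dnu_u) :
  let C := sphere_area (R := R) (n := n) ^+ 2
    * (L2norm_prod sphere (bdry Omega) (Phi_inf k) ^+ 2 +
       L2norm_prod sphere (bdry Omega) (dnu_Phi_inf nu k) ^+ 2)
    * (L2norm_prod (bdry Omega) sphere u ^+ 2 +
       L2norm_prod (bdry Omega) sphere dnu_u ^+ 2) in
  forall z : 'rV[R]_n,
    `|indicator Omega nu k u dnu_u z - indicator Omega nu k u' dnu_u' z| <=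
    C * (2 * Num.max delta1 delta2 + Num.max (delta1 ^+ 2) (delta2 ^+ 2)).

have t0 : 0 <= Num.max delta1 delta2 by rewrite le_max (ltW hdelta1).
have bound (m a b : R) : 0 <= m -> a <= b * m -> b <= Num.max delta1 delta2 ->
    a <= Num.max delta1 delta2 * m.
  by move=> m0 ab bt; rewrite (le_trans ab)// ler_wpM2r.
have b1 := bound _ _ _ (sqrtr_ge0 _) hnoise1 (ltac:(by rewrite le_max lexx)).
have b2 := bound _ _ _ (sqrtr_ge0 _) hnoise2 (ltac:(by rewrite le_max lexx orbT)).
have tt : Num.max (delta1 ^+ 2) (delta2 ^+ 2) = Num.max delta1 delta2 ^+ 2.
  have [le|le] := leP delta1 delta2.
    by rewrite max_r ?lerXn2r ?nnegrE// ltW.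
  by rewrite max_l ?lerXn2r ?nnegrE// ltW.
move=> C z; rewrite tt.
have area : 1 <= sphere_area (R := R) (n := n).
  by case: hn => ?; subst n; apply: sphere_area_ge1;
    [exact: hausdorff_circle_ge1|exact: hausdorff_sphere_ge1].
apply: (@le_trans _ _ (sphere_area (R := R) (n := n)
    * (L2norm_prod sphere (bdry Omega) (dnu_Phi_inf nu k) ^+ 2 +
       L2norm_prod sphere (bdry Omega) (Phi_inf k) ^+ 2)
    * (L2norm_prod (bdry Omega) sphere u ^+ 2 +
       L2norm_prod (bdry Omega) sphere dnu_u ^+ 2)
    * (2 * Num.max delta1 delta2 + Num.max delta1 delta2 ^+ 2))).
  by case: hn => ?; subst n; exact: indicator_stability.
rewrite /C [X in _ * X * _ * _]addrC.
rewrite !ler_wpM2r ?addr_ge0 ?sqr_ge0 ?mulr_ge0//.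
(* An area of at least 1 is at most its square. *)
by rewrite expr2 ler_peMl// (le_trans ler01).
Qed.
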